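(* Let $(\mathscr{S},d)$ be a complete metric space, let $f\colon \mathscr{S}\to(-\infty,+\infty]$ be proper and lower semicontinuous, and let $u_0\in D(f)$. Suppose that $f$ is $(p_0,\lambda)$-convex with $\lambda=0$ and some $p_0\in(1,+\infty)$. Then to every triple $(p,p',u)$ with $p,p'\in(1,+\infty)$ and $u\in \mathrm{CMS}_p([0,+\infty);u_0)$ (for arbitrary $u_0 \in D(f)$) one can associate a non-decreasing continuous map $\bm{t}_{p\to p'}=\bm{t}_{p\to p',u}\colon[0,+\infty)\to[0,T^\ast_u]$ such that: (1) the curve $u_{p'}:=u\circ \bm{t}_{p\to p'}$ belongs to $\mathrm{CMS}_{p'}([0,+\infty);u_0)$; (2) if $v\in\mathrm{CMS}_p([0,+\infty);u_0)$ is equal to $u$, then $\bm{t}_{p\to p',u}=\bm{t}_{p\to p',v}$; (3) the map $\bm{t}_{p'\to p}=\bm{t}_{p'\to p,u_{p'}}$ associated with $(p',p,u_{p'})$ satisfies the inverse transformation $u=u_{p'}\circ\bm{t}_{p'\to p}$.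
   Context: $D(f):=\{v\in\mathscr{S}: f(v)<+\infty\}$; proper means $D(f)\neq\emptyset$. $\mathscr{L}$ is Lebesgue measure. The local slope is $|\partial^- f|(v):=\limsup_{w\to v}\frac{(f(v)-f(w))^+}{d(v,w)}$ if $v\in D(f)$ and $+\infty$ otherwise, where $r^+=\max\{r,0\}$. For $a\in(0,+\infty]$, $AC_{loc}([0,a);\mathscr{S})$ is the set of curves $u\colon[0,a)\to\mathscr{S}$ for which there is $m\in L^1_{loc}([0,a))$ (integrable on compact subsets of $[0,a)$) with $d(u(s),u(t))\le\int_s^t m(r)\,dr$ for all $s\le t$ in $[0,a)$; for such $u$ the metric derivative $|u'|(t):=\lim_{s\to t}\frac{d(u(t),u(s))}{|t-s|}$ exists for $\mathscr{L}$-a.e. $t$. Let $p\in(1,+\infty)$ with conjugate exponent $q$ ($1/p+1/q=1$). A curve $u\in AC_{loc}([0,a);\mathscr{S})$ is a $p$-curve of maximal slope for $f$ starting from $u_0\in D(f)$ if $u(0)=u_0$, $f\circ u$ is non-increasing, and $(f\circ u)'(t)\le-\frac1p|u'|^p(t)-\frac1q|\partial^- f|^q(u(t))$ for $\mathscr{L}$-a.e. $t\in[0,a)$. $\mathrm{CMS}_p([0,a);u_0)$ denotes the set of all such curves defined on $[0,a)$. $f$ is $(p,\lambda)$-convex ($p\in(1,+\infty)$, $\lambda\in\mathbb{R}$) if there is $\psi\colon[0,1]\to[0,1]$ with $\lim_{t\downarrow0}\psi(t)=0$ and $\psi(t)<1$ for some $t\in(0,1)$, such that for any $v_0,v_1\in\mathscr{S}$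 there is a curve (continuous map) $\gamma\colon[0,1]\to\mathscr{S}$ from $v_0$ to $v_1$ with $d(\gamma_t,\gamma_0)\le t\,d(\gamma_1,\gamma_0)$ and $f(\gamma_t)\le(1-t)f(\gamma_0)+tf(\gamma_1)-\lambda t(1-\psi(t))d^p(\gamma_0,\gamma_1)$ for every $t\in[0,1]$. For $u\in\mathrm{CMS}_p([0,a);u_0)$, $T^\ast_u:=\sup\{t\in[0,a): |\partial^- f|(u(t))>0\}\in[0,+\infty]$ (with $\sup\emptyset=0$). The maps $\bm{t}_{p\to p'}$ may take the value $T^\ast_u=+\infty$; in that case $u(+\infty):=\lim_{t\to+\infty}u(t)$, and it is understood in (1) and (3) that this limit exists whenever the value $+\infty$ is attained. *)

(* Defs.v *)
From HB Require Import structures.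
From mathcomp Require Import all_boot all_order all_algebra.
From mathcomp Require Import all_classical all_reals all_analysis.

Set Implicit Arguments.
Unset Strict Implicit.
Unset Printing Implicit Defensive.

Import Order.TTheory GRing.Theory Num.Theory.
Import numFieldNormedType.Exports.

Local Open Scope classical_set_scope.
Local Open Scope ring_scope.

(* [Complete] includes a distinguished point; this is no restriction for the
   nonempty spaces considered here. *)
#[short(type="completeMetricType")]
HB.structure Definition CompleteMetric (R : numDomainType) :=
  {T of Complete T & Metric R T}.

Section curves_of_maximal_slope.
Context {R : realType} {S : metricType R}.
Implicit Types (f : S -> \bar R) (u : R -> S) (a : \bar R) (p : R).

Local Notation mu := (@lebesgue_measure R).

Definition effective_domain f : set S := [set v | (f v < +oo)%E].

(* The upper limit is over w <> v.  [maxe 0] only matters at an isolated point,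
   where the upper limit over the empty punctured neighbourhood would be -oo:
   there the slope is 0. *)
Definition local_slope f (v : S) : \bar R :=
  if (f v < +oo)%E then
    (maxe 0 (limf_esup (fun w => maxe (f v - f w) 0 * ((mdist v w)^-1)%:E) v^'))%E
  else +oo%E.

(* The half-open interval [0, a), with a possibly +oo.  Curves on it are
   represented by total functions R -> S whose values elsewhere are junk. *)
Definition ico0 a : set R := [set t | 0 <= t /\ (t%:E < a)%E].

Definition AC_loc a u : Prop :=
  exists m : R -> R,
    (forall K, K `<=` ico0 a -> compact K -> mu.-integrable K (EFin \o m)) /\
    (forall s t, ico0 a s -> ico0 a t -> s <= t ->
      ((mdist (u s) (u t))%:E <= \int[mu]_(r in `[s, t]) (m r)%:E)%E).

Definition metric_quotient u (t s : R) : R := mdist (u t) (u s) / `|t - s|.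

Definition metric_derivative u (t : R) : R :=
  lim (metric_quotient u t s @[s --> t^']).

(* Real-valued version of f o u, used where f o u is finite: a curve of maximal
   slope starts in the effective domain and f decreases along it. *)
Definition energy f u : R -> R := fun t => fine (f (u t)).

Definition conj_exponent p : R := fine (hoelder_conjugate p%:E).

(* Asserting the inequality at t includes that both derivatives exist at t. *)
Definition max_slope_ineq f p u (t : R) : Prop :=
  [/\ derivable (energy f u) t 1,
      cvg (metric_quotient u t s @[s --> t^']) &
      ((derive1 (energy f u) t)%:E <=
        - (p^-1 * metric_derivative u t `^ p)%:E
        - ((conj_exponent p)^-1)%:E
          * poweR (local_slope f (u t)) (conj_exponent p))%E].

Definition CMS f p a (u0 : S) : set (R -> S) := [set u |
  [/\ AC_loc a u,
      u 0 = u0,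
      (forall s t, ico0 a s -> ico0 a t -> s <= t -> (f (u t) <= f (u s))%E) &
      {ae mu, forall t, ico0 a t -> max_slope_ineq f p u t}]].

Definition Tstar f a u : \bar R :=
  (maxe 0 (ereal_sup [set t%:E | t in
    [set t | ico0 a t /\ 0 < local_slope f (u t)]]))%E.

Definition plambda_convex p (lambda : R) f : Prop :=
  exists psi : R -> R,
    [/\ (forall t : R, 0 <= t <= 1 -> 0 <= psi t <= 1),
        psi t @[t --> 0^'+] --> 0,
        (exists2 t : R, 0 < t < 1 & psi t < 1) &
        forall v0 v1 : S, exists g : R -> S,
          [/\ {within `[0, 1], continuous g}, g 0 = v0, g 1 = v1 &
              forall t : R, 0 <= t <= 1 ->
                mdist (g t) (g 0) <= t * mdist (g 1) (g 0) /\
                (f (g t) <= (1 - t)%:E * f (g 0%R) + t%:E * f (g 1%R)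
                   - (lambda * t * (1 - psi t) * mdist (g 0) (g 1) `^ p)%:E)%E]].

End curves_of_maximal_slope.

Section curve_at_infinity.
Context {R : realType} {S : completeMetricType R}.

(* Evaluation of a curve at an extended time; the value at -oo is junk. *)
Definition curve_at (u : R -> S) (t : \bar R) : S :=
  match t with
  | r%:E => u r
  | +oo => lim (u r @[r --> +oo%R])
  | -oo => u 0%R
  end%E.

End curve_at_infinity.

(* Main.v *)
Require Import Defs.
From mathcomp Require Import all_boot all_order all_algebra.
From mathcomp Require Import all_classical all_reals all_analysis.
From mathcomp Require Import measurable_realfun ring lra.

Import Order.TTheory GRing.Theory Num.Theory.
Import numFieldNormedType.Exports.

Local Open Scope classical_set_scope.
Local Open Scope ring_scope.

(** Let [u] be a curve of maximal slope for the exponent [p], let [q] be conjugate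
   to [p] and let [h t] be the slope of [f] at [u t].

   Convexity with modulus [0] turns the local slope into a global one: it bounds
   every quotient [(f v - f w) / d v w] ([local_slope_ge]).  In particular the
   energy cannot drop faster than [h * |u'|], so that the dissipation inequality
   forces equality in Young's inequality: at almost every time [|u'| = h^(q-1)]
   and [(f o u)' = - h^q] ([CMS_ae]).  Conversely these two equations imply the
   dissipation inequality ([max_slope_ineqI]).  Curves of maximal slope for
   different exponents thus run along the same path, at speeds that are
   different powers of the slope, and passing from [q] to [q'] means dividing
   the speed by [h^(q-q')].  The new time is the clock
   [sigma t = \int_0^t h^(q-q')], and the time change is its inverse, capped at
   the end of the period in which the slope is positive.

   The regularity needed for this comes from one fact: [h] is non-increasing
   ([CMS_slope_ni]).  For every competitor [w] the quotient
   [(f (u r) - f w) / d (u r) w] decreases in time, and the slope is the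
   supremum of these quotients.  Consequently, on compact
   subintervals of the active period after time [0], [h] is bounded away from
   [0] and from infinity and the clock is bi-Lipschitz ([clock_rate]); it
   therefore transports null sets and derivatives ([clock_negligible], [deriv_at_clock], [mderiv_at_clock]).  Near
   time [0] the slope may blow up, but the integral of [h^q] is controlled by
   the energy lost ([dissipation_integrable]), which suffices for the exponent
   [q - q' <= q].

   The new clock may run out in finite time although the curve never stops.
   Since the length of [u] is controlled by the clock ([length_le_clock]), the
   curve then has finite length and converges; as the clock stays bounded the
   slope tends to [0], so that the limit minimises [f] ([endpoint_slope]) and
   the new curve can rest there.

   For the reparametrised curve the exponents are exchanged, so its own clock
   has the reciprocal rate: it is the inverse function of [sigma]
   ([clock_inverse]), which gives back [u].

   Differential inequalities are integrated throughout by
   [nonincreasing_of_dini], which asks for a one-sided derivative almost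
   everywhere and a one-sided integral bound on increments. *)

Set Implicit Arguments.
Unset Strict Implicit.
Unset Printing Implicit Defensive.

(** * Monotonicity and differentiation almost everywhere *)

Section real_analysis.
Context {R : realType}.
Notation mu := (@lebesgue_measure R).
Implicit Types (F G m : R -> R) (a b c x y : R).

Lemma integrable_subitv m a b x y : a <= x -> y <= b ->
  mu.-integrable `[a, b] (EFin \o m) -> mu.-integrable `[x, y] (EFin \o m).
Proof.
move=> ax yb; apply: integrableS => //.
by apply: subset_itv; rewrite bnd_simp.
Qed.

Lemma Rintegral_chasles m a b c : a <= b -> b <= c ->
  mu.-integrable `[a, c] (EFin \o m) ->
  \int[mu]_(r in `[a, c]) m r =
  \int[mu]_(r in `[a, b]) m r + \int[mu]_(r in `[b, c]) m r.
Proof.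
move=> ab bc mi.
have := @Rintegral_itvB R m (BLeft a) (BRight c) b mi.
rewrite !bnd_simp => /(_ ab bc) H.
rewrite -(@Rintegral_itv_obnd_cbnd R b (BRight c)); last first.
  by apply: integrableS mi => //; apply: subset_itv; rewrite bnd_simp.
by rewrite -H addrC subrK.
Qed.

Lemma near_right_witness (x b : R) (P : R -> Prop) : x < b ->
  (\forall y \near x^'+, P y) ->
  exists2 d, x < d <= b & forall y, x < y -> y < d -> P y.
Proof.
move=> xb; rewrite near_withinE => /nbhs_ballP[e /= e0 xP].
exists (Num.min (x + e) b).
  by rewrite lt_min xb ltrDl e0/= ge_min lexx orbT.
move=> y xy yd; apply: (xP y) => //=.
rewrite /ball/= distrC gtr0_norm ?subr_gt0// ltrBlDl.
by rewrite (lt_le_trans yd)// ge_min lexx.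
Qed.

Lemma Rintegral_small m a b e : mu.-integrable `[a, b] (EFin \o m) -> 0 < e ->
  exists2 d, 0 < d & forall x y, a <= x -> x <= y -> y <= b -> y - x < d ->
    `|\int[mu]_(r in `[x, y]) m r| < e.
Proof.
move=> mi e0.
have mi' : mu.-integrable setT (EFin \o (m \_ `[a, b])).
  by rewrite -restrict_EFin; apply/integrable_restrict => //=; rewrite setTI.
have [d [d0 dP]] := integral_normr_continuous mi' e0.
exists d => // x y ax xy yb yxd.
have mxy : mu.-integrable `[x, y] (EFin \o m) by exact: integrable_subitv mi.
apply: le_lt_trans (le_normr_Rintegral _ mxy) _ => //.
have -> : \int[mu]_(t in `[x, y]) `|m t| =
    \int[mu]_(t in `[x, y]) `|(m \_ `[a, b]) t|.
  apply: eq_Rintegral => t; rewrite inE/= in_itv/= => /andP[xt ty].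
  rewrite patchE mem_set//= in_itv/=.
  by rewrite (le_trans ax xt) (le_trans ty yb).
apply: dP => //=; rewrite lebesgue_measure_itv/= lte_fin.
by case: ifP => // _; rewrite -EFinB lte_fin.
Qed.

(** Cover the exceptional null set by an open set [U] over which [m] has a small
   integral.  A supremum argument then shows that [F] grows by at most
   [e * (x - a)] plus the integral of [m] over the part of [U] met so far: outside
   [U] the Dini derivative is available, and inside [U] the bound on increments
   is used on a small interval that stays in [U]. *)
Lemma nonincreasing_of_dini F m a b : a <= b ->
  mu.-integrable `[a, b] (EFin \o m) -> (forall r, 0 <= m r) ->
  (forall x y, a <= x -> x <= y -> y <= b ->
     F y - F x <= \int[mu]_(r in `[x, y]) m r) ->
  {ae mu, forall x, a < x < b -> forall e, 0 < e ->
     \forall y \near x^'+, F y - F x <= e * (y - x)} ->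
  F b <= F a.
Proof.
move=> ab mi m0 Fm [N [mN N0 PN]].
apply/ler_addgt0Pl => e' e'0.
(* The total error is [e * (b - a)] from good points and [e] from [U]. *)
pose e := e' / (b - a + 1).
have ba1 : 0 < b - a + 1 by rewrite ltr_wpDl// subr_ge0.
have e0 : 0 < e by rewrite divr_gt0.
have -> : e' = e * (b - a) + e by rewrite -[in X in _ + X](mulr1 e) -mulrDr divfK// gt_eqF.
have mi' : mu.-integrable setT (EFin \o (m \_ `[a, b])).
  by rewrite -restrict_EFin; apply/integrable_restrict => //=; rewrite setTI.
have [d [d0 dP]] := integral_normr_continuous mi' e0.
(* The left endpoint, where nothing is assumed, joins the exceptional set. *)
have mA : measurable (N `|` [set a]) by exact: measurableU.
have A0 : mu (N `|` [set a]) = 0%E.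
  apply/negligibleP => //; apply: negligibleU.
    by apply/negligibleP.
  by apply/negligibleP => //; exact: lebesgue_measure_set1.
have [|U [oU AU Ud]] := @lebesgue_regularity_outer R _ d mA _ d0.
  by rewrite [X in (X < _)%E]A0.
have mU : measurable U by exact: open_measurable.
have muU : (mu U < d%:E)%E.
  apply: le_lt_trans Ud; rewrite -(setDUK AU).
  apply: (le_trans (measureU2 _ _ _)) => //; first exact: measurableD.
  by rewrite [X in (X + _)%E]A0 add0e setDUK.
pose mU' : R -> R := m \_ U.
have mUi : mu.-integrable `[a, b] (EFin \o mU').
  rewrite /mU' -restrict_EFin; apply/integrable_restrict => //=.
  by apply: integrableS mi => //; exact: measurableI.
have mU'0 r : 0 <= mU' r by rewrite /mU' patchE; case: ifP.
pose M x := \int[mu]_(r in `[a, x]) mU' r.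
have MB x y : a <= x -> x <= y -> y <= b ->
    M y = M x + \int[mu]_(r in `[x, y]) mU' r.
  move=> ax xy yb; rewrite /M (@Rintegral_chasles _ a x y)//.
  exact: integrable_subitv mUi.
have Mmono x y : a <= x -> x <= y -> y <= b -> M x <= M y.
  by move=> ax xy yb; rewrite (MB x y)// lerDl Rintegral_ge0.
have Ma : M a = 0 by rewrite /M set_itv1 Rintegral_set1.
have Mb : M b < e.
  apply: le_lt_trans (dP _ mU muU); rewrite /M /mU' -Rintegral_mkcondr.
  have abU : mu.-integrable (`[a, b] `&` U) (EFin \o m).
    by apply: integrableS mi => //; exact: measurableI.
  rewrite setIC Rintegral_mkcondr.
  rewrite le_eqVlt; apply/orP; left; apply/eqP.
  apply: eq_Rintegral => r rU; rewrite ger0_norm// patchE.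
  by case: ifP.
pose claim x := F x - F a <= e * (x - a) + M x.
suff : claim b.
  by rewrite /claim => H; have := Mb; lra.
pose A := [set x | a <= x <= b /\ forall z, a <= z <= x -> claim z].
have Aa : A a.
  split; first by rewrite lexx ab.
  move=> z; rewrite -eq_le => /eqP <-.
  by rewrite /claim !subrr mulr0 Ma addr0.
have supA : has_sup A.
  by split; [exists a | exists b => x [/andP[]]].
pose c := sup A.
have ac : a <= c by apply: ub_le_sup => //; case: supA.
have cb : c <= b by apply: sup_le_ub; [exists a | move=> x [/andP[]]].
have claimlt z : a <= z -> z < c -> claim z.
  move=> az zc; have cz : 0 < c - z by rewrite subr_gt0.
  have [w [/andP[aw wb] Aw] cw] := sup_adherent cz supA.
  apply: Aw; rewrite az/=; apply: ltW.
  by move: cw; rewrite subKr.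
have claimc : claim c.
  move: ac; rewrite le_eqVlt => /predU1P[<-|ac]; first by case: Aa => _; apply; rewrite !lexx.
  rewrite /claim; apply/ler_addgt0Pl => e1 e10.
  have [d1 d10 d1P] := Rintegral_small mi e10.
  pose z := Num.max a (c - d1 / 2).
  have az : a <= z by rewrite le_max lexx.
  have zc : z < c by rewrite gt_max ac/= ltrBlDl ltrDr divr_gt0.
  have := claimlt _ az zc; rewrite /claim.
  have := Fm z c az (ltW zc) cb.
  have czd : c - z < d1.
    rewrite ltrBlDr -ltrBlDl lt_max; apply/orP; right.
    by rewrite ltrD2l ltrN2 ltr_pdivrMr// ltr_pMr// ltr1n.
  have /(le_lt_trans (ler_norm _)) := d1P _ _ az (ltW zc) cb czd.
  have := Mmono _ _ az (ltW zc) cb.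
  have : e * (z - a) <= e * (c - a) by rewrite ler_pM2l// lerD2r ltW.
  by lra.
move: cb; rewrite le_eqVlt => /predU1P[<-//|cb].
exfalso.
suff [y cy [yb Hy]] : exists2 y, c < y & y <= b /\ forall z, c < z -> z <= y ->
    F z - F c <= e * (z - c) + (M z - M c).
  have : A y.
    split; first by rewrite yb (le_trans ac (ltW cy)).
    move=> z /andP[az zy]; have [zc|cz|->//] := ltgtP z c; first exact: claimlt.
    have := Hy _ cz zy; move: claimc; rewrite /claim.
    lra.
  by move=> /(ub_le_sup (proj2 supA)); rewrite leNgt cy.
have [Uc|Uc] := pselect (U c).
  have : \forall y \near c^'+, U y.
    by apply: cvg_within; exact: open_nbhs_nbhs.
  move=> /(near_right_witness cb)[d1 /andP[cd1 d1b] d1P].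
  have c1d : (c + d1) / 2 < d1 by lra.
  exists ((c + d1) / 2); first by lra.
  split; first by lra.
  move=> z cz zd; rewrite (MB c z ac (ltW cz)); last by lra.
  rewrite addrAC subrr add0r.
  have : F z - F c <= \int[mu]_(r in `[c, z]) m r.
    by apply: Fm => //; [exact: ltW|lra].
  have -> : \int[mu]_(r in `[c, z]) m r = \int[mu]_(r in `[c, z]) mU' r.
    apply: eq_Rintegral => r; rewrite inE/= in_itv/= => /andP[cr rz].
    rewrite /mU' patchE mem_set//.
    move: cr; rewrite le_eqVlt => /predU1P[<-//|cr]; apply: d1P => //; lra.
  have : 0 <= e * (z - c) by rewrite mulr_ge0 ?subr_ge0// ltW.
  by lra.
have Nc : ~ N c by move=> Nc; apply: Uc; apply: AU; left.
have ca : a < c.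
  rewrite lt_neqAle ac andbT; apply/eqP => ac'; apply: Uc; apply: AU; right.
  by rewrite /= ac'.
have : \forall y \near c^'+, F y - F c <= e * (y - c).
  have H : a < c < b by rewrite ca cb.
  have := contra_notP (PN c) Nc; rewrite /= => /(_ H e e0); exact.
move=> /(near_right_witness cb)[d1 /andP[cd1 d1b] d1P].
exists ((c + d1) / 2); first by lra.
split; first by lra.
move=> z cz zd; have zd1 : z < d1 by lra.
have := d1P z cz zd1.
have : M c <= M z by apply: Mmono => //; [exact: ltW|lra].
by lra.
Qed.

Lemma ae_imply (P Q : R -> Prop) : (forall x, P x -> Q x) ->
  {ae mu, forall x, P x} -> {ae mu, forall x, Q x}.
Proof. by move=> PQ; apply: (@filterS _ _ (ae_filter_ringOfSetsType mu)). Qed.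

Lemma ae_and (P Q : R -> Prop) : {ae mu, forall x, P x} ->
  {ae mu, forall x, Q x} -> {ae mu, forall x, P x /\ Q x}.
Proof. exact: (@filterI _ _ (ae_filter_ringOfSetsType mu)). Qed.

(** Each interval of a cheap open cover of [N] is mapped into an interval at most
   [C] times longer. *)
Lemma negligible_image_lipschitz (s : R -> R) (C a b : R) (N : set R) :
  0 < C ->
  (forall x y, a <= x -> x <= y -> y <= b -> 0 <= s y - s x <= C * (y - x)) ->
  mu.-negligible N -> mu.-negligible (s @` (N `&` `[a, b])).
Proof.
move=> C0 sC /negligible_outer_measure N0.
apply/negligible_outer_measure/eqP; rewrite eq_le outer_measure_ge0 andbT.
apply/lee_addgt0Pr => /= e e0; rewrite add0e.
have eC0 : 0 < e / C by rewrite divr_gt0.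
have [F NF Fe] : exists2 F, open_itv_cover N F &
    (\sum_(0 <= k <oo) wlength idfun (F k) < (e / C)%:E)%E.
  move: N0; rewrite outer_measure_open_itv_cover => N0.
  have : (ereal_inf [set (\sum_(0 <= k <oo) wlength idfun (F k))%E |
      F in open_itv_cover N] < (e / C)%:E)%E by rewrite N0 lte_fin.
  by move=> /ereal_inf_lt[_ [F NF <-] Fe]; exists F.
have [NF1 NF2] := NF.
pose l k := Num.max a (projT1 (cid (NF1 k))).1.
pose r k := Num.min b (projT1 (cid (NF1 k))).2.
pose J k : set R := if (l k <= r k) then `[s (l k), s (r k)]%classic else set0.
have JF k : (mu (J k) <= C%:E * wlength idfun (F k))%E.
  rewrite /J /l /r; case: (cid _) => -[x y] /= ->.
  case: ifPn => [lr|_]; last first.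
    by rewrite measure0 mule_ge0 ?wlength_ge0// lee_fin ltW.
  rewrite lebesgue_measure_itv/= wlength_itv/= !lte_fin.
  have xl : x <= Num.max a x by rewrite le_max lexx orbT.
  have ry : Num.min b y <= y by rewrite ge_min lexx orbT.
  have al : a <= Num.max a x by rewrite le_max lexx.
  have rb : Num.min b y <= b by rewrite ge_min lexx.
  have /andP[_ sCxy] := sC _ _ al lr rb.
  have xy : x <= y by rewrite (le_trans xl)// (le_trans lr).
  have : C * (Num.min b y - Num.max a x) <= C * (y - x).
    by rewrite ler_pM2l// lerB.
  move=> /(le_trans sCxy) sxy.
  case: ifPn => _; last first.
    by case: ifPn => _; rewrite ?mule0// -EFinD -EFinM lee_fin mulr_ge0 ?subr_ge0// ltW.
  case: ifPn => [_|]; first by rewrite -!EFinD -EFinM lee_fin.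
  rewrite -leNgt => yx; rewrite mule0 -EFinD lee_fin (le_trans sxy)//.
  by rewrite mulr_ge0_le0// ?subr_le0// ltW.
apply: (@le_trans _ _ (mu (\bigcup_k J k))).
  apply: le_outer_measure => _ [x [Nx /=]] + <-.
  rewrite in_itv/= => /andP[ax xb].
  have [k _ Fkx] := NF2 _ Nx; exists k => //.
  move: Fkx; rewrite /J /l /r; case: (cid _) => -[y z] /= ->.
  rewrite /= in_itv/= => /andP[yx xz].
  have lx : Num.max a y <= x by rewrite ge_max ax ltW.
  have xr : x <= Num.min b z by rewrite le_min xb ltW.
  have al : a <= Num.max a y by rewrite le_max lexx.
  have rb : Num.min b z <= b by rewrite ge_min lexx.
  rewrite (le_trans lx xr) /= in_itv/=; apply/andP; split; rewrite -subr_ge0.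
    by case/andP: (sC _ _ al lx xb).
  by case/andP: (sC _ _ ax xr rb).
apply: le_trans (outer_measure_sigma_subadditive mu J) _.
apply: (@le_trans _ _ (\sum_(0 <= k <oo) (C%:E * wlength idfun (F k)))%E).
  by apply: lee_nneseries => [k _ _|k _]; [exact: measure_ge0|exact: JF].
rewrite nneseriesZl; last by move=> k _; exact: wlength_ge0.
apply: (@le_trans _ _ (C%:E * (e / C)%:E)%E).
  by rewrite lee_pmul2l// ltW.
by rewrite -EFinM lee_fin mulrC divfK// gt_eqF.
Qed.

(** First-order expansion, equivalent to differentiability at [x]; estimates
   on increments compose more easily in this form than limits of quotients. *)
Definition deriv_at F x l := forall e, 0 < e ->
  \forall y \near x, `|F y - F x - l * (y - x)| <= e * `|y - x|.

Lemma deriv_at_derivable F x : derivable F x 1 -> deriv_at F x (derive1 F x).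
Proof.
move=> Fx e e0; rewrite derive1E; set D := 'D_1 F x.
have /cvgrPdist_le/(_ e e0) : (fun h => h^-1 *: (F (h *: 1 + x) - F x)) @ 0^' --> D.
  exact: Fx.
rewrite near_withinE => /nbhs_ballP[d /= d0 dP].
apply/nbhs_ballP; exists d => //= y; rewrite /ball/= => xyd.
have [->|yx] := eqVneq y x; first by rewrite !subrr mulr0 subr0 !normr0 mulr0.
have yx0 : y - x != 0 by rewrite subr_eq0.
have := dP (y - x); rewrite /ball/= sub0r normrN (distrC y x) => /(_ xyd yx0).
rewrite /GRing.scale/= mulr1 subrK.
rewrite -(ler_pM2r (_ : 0 < `|y - x|)) ?normr_gt0// -normrM mulrBl.
by rewrite mulrAC mulVf// mul1r (distrC (F y - F x)) (distrC x y).
Qed.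

Lemma derivable_deriv_at F x l : deriv_at F x l ->
  derivable F x 1 /\ derive1 F x = l.
Proof.
move=> Fxl.
have H : (fun h => h^-1 *: (F (h *: 1 + x) - F x)) @ 0^' --> l.
  apply/cvgrPdist_le => e e0; have := Fxl e e0.
  move=> /nbhs_ballP[d /= d0 dP].
  rewrite near_withinE; apply/nbhs_ballP; exists d => //= h.
  rewrite /ball/= sub0r normrN => hd h0.
  have := dP (h + x); rewrite /ball/= opprD addrCA subrr addr0 normrN => /(_ hd).
  rewrite addrK -[h *: 1]/(h * 1) mulr1 => H.
  rewrite -(ler_pM2r (_ : 0 < `|h|)) ?normr_gt0// -normrM mulrBl.
  by rewrite -[_ *: _]/(_ * _) mulrAC mulVf// mul1r distrC.
split; first by apply/cvg_ex; exists l.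
rewrite derive1E /derive; apply/cvg_lim => //.
Qed.

Lemma near_deriv_at F G x l : (\forall y \near x, F y = G y) ->
  deriv_at F x l -> deriv_at G x l.
Proof.
move=> FG Fl e e0; have Fx := nbhs_singleton FG.
near=> y.
have <- : F y = G y by near: y.
by rewrite -Fx; near: y; exact: Fl.
Unshelve. all: end_near. Qed.

(** Lebesgue differentiation, localised to an interval of integrability. *)
Lemma ae_deriv_integral m a b : a <= b -> mu.-integrable `[a, b] (EFin \o m) ->
  {ae mu, forall x, a < x < b ->
    deriv_at (fun y => \int[mu]_(r in `[a, y]) m r) x (m x)}.
Proof.
move=> ab mi; pose f := m \_ `[a, b].
have mi' : mu.-integrable setT (EFin \o f).
  by rewrite /f -restrict_EFin; apply/integrable_restrict => //=; rewrite setTI.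
have intf y : mu.-integrable `[a, y] (EFin \o f) by exact: integrableS mi'.
have := @FTC1 R f (BLeft a) intf (integrable_locally (measurable_itv _) mi).
apply: ae_imply => x H /andP[ax xb].
have [|df f'x] := H; first by rewrite lte_fin.
have fx : f x = m x by rewrite /f patchE mem_set//= in_itv/= !ltW.
have := deriv_at_derivable df; rewrite f'x fx.
apply: near_deriv_at; near=> y.
apply: eq_Rintegral => r; rewrite inE/= in_itv/= => /andP[ar ry].
rewrite /f patchE mem_set//= in_itv/= ar (le_trans ry)//.
by apply: ltW; near: y; exact: lt_nbhsl.
Unshelve. all: end_near. Qed.

End real_analysis.

(** * Integrability of a monotone dissipation rate *)

Section dissipation.
Context {R : realType}.
Notation mu := (@lebesgue_measure R).
Implicit Types (m : R -> R) (a b x y : R).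

Lemma nonincreasing_on_measurable (f : R -> R) :
  (forall x y, 0 < x -> x <= y -> f y <= f x) -> measurable_fun `](0:R), +oo[ f.
Proof.
move=> f_ni; apply: (measurability (@RGenInftyO.G R)) => [|/= _ [_] [r] -> <-].
  exact: RGenInftyO.measurableE.
apply: is_interval_measurable => s t/=.
rewrite !in_itv/= !andbT => -[s0 fs] [t0 ft] u /andP[su ut].
have u0 : 0 < u by rewrite (lt_le_trans s0).
by rewrite !in_itv/= !andbT u0 (le_lt_trans _ fs)// f_ni.
Qed.

Lemma integrable_bounded_itv (f : R -> R) a b C : measurable_fun `[a, b] f ->
  (forall x, a <= x <= b -> 0 <= f x <= C) ->
  mu.-integrable `[a, b] (EFin \o f).
Proof.
move=> mf fC; apply: measurable_bounded_integrable => //.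
  exact/compact_finite_measure/segment_compact.
exists C; split; first exact: num_real.
move=> M CM x; rewrite /= in_itv/= => /fC/andP[f0 fxC].
by rewrite ger0_norm// (le_trans fxC)// ltW.
Qed.

Lemma Rintegral_itv_cst a b C : a <= b ->
  \int[mu]_(r in `[a, b]) C = C * (b - a).
Proof.
move=> ab; rewrite Rintegral_cst//; congr (_ * _).
have -> : b - a = fine (b - a)%:E by [].
congr fine; rewrite -[LHS]/(lebesgue_measure `[a, b]%classic) lebesgue_measure_itv/=.
by rewrite lte_fin; case: ltgtP ab => // ->; rewrite subrr.
Qed.

Lemma Rintegral_le_cst m a b C : a <= b -> mu.-integrable `[a, b] (EFin \o m) ->
  (forall x, a <= x <= b -> m x <= C) ->
  \int[mu]_(r in `[a, b]) m r <= C * (b - a).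
Proof.
move=> ab mi mC; rewrite -Rintegral_itv_cst//.
apply: le_Rintegral => //.
  by apply: measurable_bounded_integrable => //;
    [exact/compact_finite_measure/segment_compact|exact: bounded_cst].
Qed.

Lemma Rintegral_ge_cst m a b C : a <= b -> mu.-integrable `[a, b] (EFin \o m) ->
  (forall x, a <= x <= b -> C <= m x) ->
  C * (b - a) <= \int[mu]_(r in `[a, b]) m r.
Proof.
move=> ab mi mC; rewrite -Rintegral_itv_cst//.
apply: le_Rintegral => //.
  by apply: measurable_bounded_integrable => //;
    [exact/compact_finite_measure/segment_compact|exact: bounded_cst].
Qed.

Lemma near_right_of_near (x : R) (P : R -> Prop) :
  (\forall y \near x, P y) -> \forall y \near x^'+, P y.
Proof. by move=> xP; apply: cvg_within. Qed.

(** The rate [H] may blow up at [0].  On [[e, K]] it is bounded, and there the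
   function [E + \int H] decreases, so that the integral is at most the total
   drop [E 0 - E K], independently of [e].  Since [H] is
   monotone, the increments of its integral after [x] are at most
   [H x * (y - x)]. *)
Lemma dissipation_integrable (E H : R -> R) K : 0 < K ->
  (forall x, 0 <= H x) ->
  (forall x y, 0 < x -> x <= y -> H y <= H x) ->
  (forall x y, 0 <= x -> x <= y -> E y <= E x) ->
  {ae mu, forall x, 0 < x -> deriv_at E x (- H x)} ->
  mu.-integrable `[0, K] (EFin \o H).
Proof.
move=> K0 H0 Hni Eni Ed.
have mH0 := nonincreasing_on_measurable Hni.
have mHe e : 0 < e -> measurable_fun `[e, K] H.
  move=> e0; apply: measurable_funS mH0 => // x; rewrite /= !in_itv/= andbT.
  by move=> /andP[ex _]; exact: lt_le_trans ex.
have iHe e : 0 < e -> mu.-integrable `[e, K] (EFin \o H).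
  move=> e0; apply: (@integrable_bounded_itv _ _ _ (H e)); first exact: mHe.
  by move=> x /andP[ex _]; rewrite H0 Hni.
have bound e : 0 < e -> (\int[mu]_(x in `[e, K]) (H x)%:E <= (E 0 - E K)%:E)%E.
  move=> e0; have [eK|Ke] := leP e K; last first.
    by rewrite set_itv_ge ?integral_set0 ?lee_fin ?subr_ge0 ?Eni ?(ltW K0)// bnd_simp -ltNge.
  suff : \int[mu]_(x in `[e, K]) H x <= E 0 - E K.
    rewrite -lee_fin /Rintegral fineK//; apply: integrable_fin_num => //.
    exact: iHe.
  have -> : \int[mu]_(x in `[e, K]) H x = (E K + \int[mu]_(x in `[e, K]) H x) - E K.
    by rewrite addrAC subrr add0r.
  rewrite lerD2r (@le_trans _ _ (E e))//; last by apply: Eni => //; exact: ltW.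
  have -> : E e = E e + \int[mu]_(x in `[e, e]) H x.
    by rewrite set_itv1 Rintegral_set1 addr0.
  apply: (@nonincreasing_of_dini _ (fun z => E z + \int[mu]_(x in `[e, z]) H x) H) => //.
  - exact: iHe.
  - move=> x y ex xy yK; rewrite (@Rintegral_chasles _ H e x y)//; last first.
      by apply: integrable_subitv (iHe _ e0).
    have : E y <= E x by apply: Eni => //; rewrite (le_trans (ltW e0)).
    by lra.
  apply: ae_imply Ed => x Ed /andP[ex xK] d d0.
  have x0 : 0 < x by rewrite (lt_trans e0).
  near=> y.
  have xy : x < y by near: y; exact: nbhs_right_gt.
  have yK : y <= K by near: y; exact: nbhs_right_le.
  rewrite (@Rintegral_chasles _ H e x y (ltW ex) (ltW xy)); last first.
    by apply: integrable_subitv (iHe _ e0).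
  have : \int[mu]_(r in `[x, y]) H r <= H x * (y - x).
    apply: Rintegral_le_cst; first exact: ltW.
      by apply: integrable_subitv (iHe _ e0) => //; exact: ltW.
    by move=> z /andP[xz _]; exact: Hni.
  have : E y - E x <= (d - H x) * (y - x).
    have : `|E y - E x - - H x * (y - x)| <= d * `|y - x|.
      by near: y; apply: near_right_of_near; exact: Ed.
    rewrite (gtr0_norm (_ : 0 < y - x)) ?subr_gt0// => /(le_trans (ler_norm _)).
    by lra.
  by lra.
have : (\int[mu]_(x in `]0%R, K]) (H x)%:E <= (E 0 - E K)%:E)%E.
  have -> : `](0:R), K]%classic = \bigcup_n `[(n.+1%:R^-1 : R), K]%classic.
    apply/seteqP; split => [x/=|x [n _]]; rewrite /= !in_itv/=.
      move=> /andP[x0 xK]; exists (Num.truncn x^-1) => //=; rewrite in_itv/= xK andbT.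
      rewrite -[leRHS]invrK lef_pV2 ?posrE ?invr_gt0//.
      by apply: ltW; exact: truncnS_gt.
    by move=> /andP[nx ->]; rewrite (lt_le_trans _ nx).
  have := @ge0_nondecreasing_set_cvg_integral _ (measurableTypeR R) R
    (fun n => `[(n.+1%:R^-1 : R), K]%classic) (EFin \o H) mu.
  have nnd : nondecreasing_seq (fun n => `[(n.+1%:R^-1 : R), K]%classic).
    move=> n k nk; rewrite subsetEset; apply: subset_itvr; rewrite bnd_simp.
    by rewrite lef_pV2 ?posrE// ler_nat.
  move=> /(_ nnd (fun=> measurable_itv _)).
  have mHn n : measurable_fun `[(n.+1%:R^-1 : R), K] (EFin \o H).
    by apply/measurable_EFinP; exact: mHe.
  have Hn0 n x : `[(n.+1%:R^-1 : R), K]%classic x -> (0 <= (EFin \o H) x)%E.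
    by rewrite lee_fin.
  move=> /(_ mHn Hn0) cv.
  have <- := cvg_lim _ cv => //.
  apply: lime_le; first by apply/cvg_ex; eexists; exact: cv.
  by near=> n; exact: bound.
move=> HEK.
have mH : measurable_fun `[0, K] (EFin \o H).
  apply/measurable_EFinP/measurable_fun_itv_obnd_cbndP.
  apply: measurable_funS mH0 => //; exact: subset_itvl.
apply/integrableP; split => //.
under eq_integral do rewrite gee0_abs ?lee_fin//.
rewrite -integral_itv_obnd_cbnd; last exact/emeasurable_fun_itv_obnd_cbndP.
by apply: le_lt_trans HEK _; rewrite ltry.
Unshelve. all: end_near. Qed.

End dissipation.

(** * Conjugate exponents and global slopes *)

Section exponents.
Context {R : realType}.
Implicit Types p q x y : R.

Lemma conj_exponentE p : 1 < p ->
  1 < conj_exponent p /\ p^-1 + (conj_exponent p)^-1 = 1.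
Proof.
move=> p1; have p0 : p != 0 by rewrite gt_eqF// (lt_trans ltr01).
have E : conj_exponent p = p / (p - 1).
  rewrite /conj_exponent /hoelder_conjugate/= eqe (negbTE p0).
  rewrite -EFinD inver subr_eq0 gt_eqF// -EFinM//=.
have p10 : 0 < p - 1 by rewrite subr_gt0.
split; first by rewrite E ltr_pdivlMr// mul1r ltrBlDr ltrDl.
by rewrite E; field; rewrite p0 gt_eqF.
Qed.

Lemma conj_exponent_mul p q : p != 0 -> q != 0 -> p^-1 + q^-1 = 1 ->
  (q - 1) * p = q.
Proof.
move=> p0 q0 H.
have H2 : q * p * (p^-1 + q^-1) = q + p by field; rewrite p0 q0.
by move: H2; rewrite H mulr1; lra.
Qed.

(** Young's inequality is strict away from its equality case: after dividing
   by [x * y] both sides are exponentials of the same defect [z], to which the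
   strict inequality [1 + z < exp z] applies. *)
Lemma young_eq p q x y : 1 < p -> 1 < q -> p^-1 + q^-1 = 1 ->
  0 <= x -> 0 <= y ->
  p^-1 * x `^ p + q^-1 * y `^ q <= x * y -> x = y `^ (q - 1).
Proof.
move=> p1 q1 pq x0 y0 xy.
have p0 : 0 < p by rewrite (lt_trans ltr01).
have q0 : 0 < q by rewrite (lt_trans ltr01).
have [yz|yn0] := eqVneq y 0.
  move: xy; rewrite yz mulr0 !powR0 ?gt_eqF ?subr_gt0// mulr0 addr0.
  rewrite pmulr_rle0 ?invr_gt0// => xp.
  have /eqP : x `^ p == 0 by rewrite eq_le xp powR_ge0.
  by move/powR_eq0_eq0.
have {yn0} y0' : 0 < y by rewrite lt_neqAle eq_sym yn0.
have [xz|xn0] := eqVneq x 0.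
  move: xy; rewrite xz mul0r powR0 ?gt_eqF// mulr0 add0r.
  by rewrite pmulr_rle0 ?invr_gt0// leNgt powR_gt0.
have {xn0} x0' : 0 < x by rewrite lt_neqAle eq_sym xn0.
pose z := ln x - (q - 1) * ln y.
(* [z] is the logarithm of [x / y^(q-1)]. *)
have [z0|z0] := eqVneq z 0.
  apply: ln_inj; rewrite ?posrE ?powR_gt0// ln_powR.
  by move/eqP: z0; rewrite subr_eq0 => /eqP.
have pq1 : (p - 1) * (q - 1) = 1.
  have := conj_exponent_mul (lt0r_neq0 p0) (lt0r_neq0 q0) pq; lra.
have exy : x * y = expR (ln x + ln y) by rewrite expRD !lnK ?posrE.
have e1 : x `^ p = x * y * expR ((p - 1) * z).
  rewrite exy -expRD /powR gt_eqF//; congr expR.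
  by rewrite /z; transitivity (ln x + (p - 1) * ln x + (1 - (p - 1) * (q - 1)) * ln y); [rewrite pq1|]; ring.
have e2 : y `^ q = x * y * expR (- z).
  rewrite exy -expRD /powR gt_eqF//; congr expR.
  by rewrite /z; ring.
have xy0 : 0 < x * y by rewrite mulr_gt0.
have H1 : 1 + (p - 1) * z < expR ((p - 1) * z).
  by rewrite expR_gt1Dx// mulf_neq0// gt_eqF// subr_gt0.
have H2 : 1 - z < expR (- z) by rewrite expR_gt1Dx// oppr_eq0.
have : p^-1 * (x * y * expR ((p - 1) * z)) + q^-1 * (x * y * expR (- z)) <= x * y.
  by rewrite -e1 -e2.
have -> : p^-1 * (x * y * expR ((p - 1) * z)) + q^-1 * (x * y * expR (- z)) =
   (x * y) * (p^-1 * expR ((p - 1) * z) + q^-1 * expR (- z)) by ring.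
rewrite -[leRHS]mulr1 ler_pM2l// => H3.
have : p^-1 * (1 + (p - 1) * z) + q^-1 * (1 - z) < 1.
  apply: lt_le_trans H3; apply: ltrD; rewrite ltr_pM2l ?invr_gt0//.
have -> : p^-1 * (1 + (p - 1) * z) + q^-1 * (1 - z) =
  (p^-1 + q^-1) * (1 - z) + p^-1 * p * z by ring.
by rewrite pq mulVf ?gt_eqF// mul1r mul1r subrK ltxx.
Qed.

End exponents.

Section slopes.
Context {R : realType} {S : metricType R}.
Variable f : S -> \bar R.
Hypothesis f_gtNy : forall v, (-oo < f v)%E.

Let fK v : (f v < +oo)%E -> (fine (f v))%:E = f v.
Proof. by move=> fv; rewrite fineK// fin_numElt f_gtNy. Qed.

Lemma local_slope_ge0 v : (0 <= local_slope f v)%E.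
Proof. by rewrite /local_slope; case: ifP; rewrite ?le_max ?lexx ?leey. Qed.

(** The bound over all competitors trivially bounds the upper limit; the
   hypothesis [0 <= c] covers isolated points. *)
Lemma local_slope_le v c : (f v < +oo)%E -> 0 <= c ->
  (forall w, (f w < +oo)%E -> fine (f v) - fine (f w) <= c * mdist v w) ->
  (local_slope f v <= c%:E)%E.
Proof.
move=> fv c0 H; rewrite /local_slope fv ge_max lee_fin c0/=.
rewrite limf_esupE; apply: ge_ereal_inf.
exists (ereal_sup [set (maxe (f v - f w) 0 * ((mdist v w)^-1)%:E)%E |
   w in [set w | w != v]]).
  exists [set w | w != v] => //.
  by rewrite /dnbhs /within/=; exact: nearW.
apply: ge_ereal_sup => _ [w /= wv <-].
have d0 : 0 < mdist v w by rewrite mdist_gt0 eq_sym.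
have [fw|] := boolP (f w < +oo)%E; last first.
  rewrite -leNgt leye_eq => /eqP ->.
  by rewrite -fK//= max_r ?mul0e ?lee_fin// leNye.
rewrite -(fK fv) -(fK fw) -EFinB -EFin_max -EFinM lee_fin.
by rewrite ler_pdivrMr// ge_max H//= mulr_ge0// ltW.
Qed.

Variable p0 : R.
Hypothesis f_convex : plambda_convex p0 0 f.

(** Along a convexity curve from [v] to [w] the difference quotients of [f] at
   [v] stay above the one at [w], so the local slope already sees it. *)
Lemma local_slope_ge v w c : (f v < +oo)%E -> (f w < +oo)%E ->
  (local_slope f v <= c%:E)%E -> fine (f v) - fine (f w) <= c * mdist v w.
Proof.
move=> fv fw slc.
have c0 : 0 <= c by rewrite -lee_fin (le_trans (local_slope_ge0 v)).
rewrite leNgt; apply/negP => cD.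
have D0 : 0 < fine (f v) - fine (f w).
  by rewrite (le_lt_trans _ cD)// mulr_ge0// mdist_ge0.
have d0 : 0 < mdist v w.
  by rewrite mdist_gt0; apply: contraTneq D0 => ->; rewrite subrr ltxx.
move: slc; apply/negP; rewrite -ltNge /local_slope fv.
set b := (fine (f v) - fine (f w)) / mdist v w.
have cb : (c%:E < b%:E)%E by rewrite lte_fin ltr_pdivlMr.
apply: lt_le_trans cb _; rewrite le_max; apply/orP; right.
rewrite limf_esupE; apply: le_ereal_inf_tmp => _ [V Vv <-].
move: Vv; rewrite /dnbhs /within/=.
move=> /metricType_numDomainType.nbhs_mdistP[e /= e0 eV].
have [psi [_ _ _ /(_ v w)[g [_ g0 g1 gP]]]] := f_convex.
(* Small enough for the point at parameter [t] to lie in the given ball. *)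
pose t := Num.min 1 (e / (2 * mdist v w)).
have t0 : 0 < t by rewrite lt_min ltr01 divr_gt0// mulr_gt0.
have t1 : t <= 1 by rewrite ge_min lexx.
have t01 : 0 <= t <= 1 by rewrite ltW.
have [gd gf] := gP _ t01.
rewrite g0 g1 in gd; rewrite g0 g1 mul0r mul0r mul0r in gf.
rewrite oppe0 adde0 -(fK fv) -(fK fw) -!EFinM -EFinD in gf.
have fg : (f (g t) < +oo)%E by rewrite (le_lt_trans gf)// ltry.
rewrite -(fK fg) lee_fin in gf.
have Dt : t * (fine (f v) - fine (f w)) <= fine (f v) - fine (f (g t)).
  by move: gf; lra.
have gv : g t != v.
  apply/eqP => gv; move: Dt; rewrite gv subrr leNgt => /negP; apply.
  by rewrite mulr_gt0.
have dg0 : 0 < mdist v (g t) by rewrite mdist_gt0 eq_sym.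
have gd' : mdist v (g t) <= t * mdist v w.
  by rewrite metric_sym (metric_sym v w).
apply: le_ereal_sup_tmp.
exists (maxe (f v - f (g t)) 0 * ((mdist v (g t))^-1)%:E)%E.
  exists (g t) => //; apply: eV => //=.
  apply: le_lt_trans gd' _.
  apply: (@le_lt_trans _ _ (e / (2 * mdist v w) * mdist v w)).
    by rewrite ler_pM2r// /t ge_min lexx orbT.
  rewrite invfM mulrA divfK ?gt_eqF//.
  by rewrite ltr_pdivrMr// ltr_pMr// ltr1n.
rewrite -(fK fv) -(fK fg) -EFinB -EFin_max -EFinM lee_fin /b.
rewrite ler_pdivrMr// mulrAC ler_pdivlMr//.
apply: (@le_trans _ _ ((fine (f v) - fine (f w)) * (t * mdist v w))).
  by rewrite ler_pM2l.
rewrite mulrA ler_pM2r// mulrC (le_trans Dt)// le_max lexx//.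
Qed.

End slopes.

(** * Pointwise description of curves of maximal slope *)

Section metric_derivative.
Context {R : realType} {S : metricType R}.
Implicit Types (u : R -> S) (x l : R).

(** The analogue for curves of the first-order expansion of real functions. *)
Definition mderiv_at u x l := forall e, 0 < e ->
  \forall y \near x, `|mdist (u x) (u y) - l * `|y - x| | <= e * `|y - x|.

Lemma mderiv_atP u x l :
  metric_quotient u x s @[s --> x^'] --> l <-> mderiv_at u x l.
Proof.
split=> [/cvgrPdist_le H e e0|H].
  have := H e e0; rewrite !near_withinE; apply: filterS => y.
  have [->|yx] := eqVneq y x; first by rewrite mdistxx !subrr normr0 !mulr0 subr0 normr0.
  move=> /(_ isT); rewrite /metric_quotient => H1.
  have d0 : 0 < `|y - x| by rewrite normr_gt0 subr_eq0.
  rewrite -(ler_pM2r d0) -{1}(normr_id (y - x)) -normrM mulrBl in H1.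
  by rewrite (distrC x y) divfK ?gt_eqF// distrC in H1.
apply/cvgrPdist_le => e e0; rewrite !near_withinE.
apply: filterS (H e e0) => y H1 yx.
have d0 : 0 < `|y - x| by rewrite normr_gt0 subr_eq0.
rewrite -(ler_pM2r d0) -{1}(normr_id (y - x)) -normrM mulrBl.
by rewrite /metric_quotient (distrC x y) divfK ?gt_eqF// distrC.
Qed.

Lemma mdist_sub_le (a b c : S) : mdist a c - mdist a b <= mdist b c.
Proof. by rewrite lerBlDl metric_triangle. Qed.

End metric_derivative.

Section maximal_slope.
Context {R : realType} {S : completeMetricType R}.
Notation mu := (@lebesgue_measure R).
Variable f : S -> \bar R.
Hypothesis f_gtNy : forall v, (-oo < f v)%E.
Variable p0 : R.
Hypothesis f_convex : plambda_convex p0 0 f.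
Variables (p : R) (u0 : S) (u : R -> S).
Hypotheses (p1 : 1 < p) (u0f : effective_domain f u0) (uC : CMS f p +oo%E u0 u).

Let q := conj_exponent p.
Let E := energy f u.
Let h t := fine (local_slope f (u t)).

Let ico0y (t : R) : 0 <= t -> ico0 +oo%E t.
Proof. by move=> t0; split => //; exact: ltry. Qed.

Let q1 : 1 < q. Proof. exact: (conj_exponentE p1).1. Qed.

Lemma CMS_dom t : 0 <= t -> (f (u t) < +oo)%E.
Proof.
move=> t0; have [_ u00 fu _] := uC.
have := fu 0 t (ico0y (lexx 0)) (ico0y t0) t0.
by move=> /le_lt_trans; apply; rewrite u00; exact: u0f.
Qed.

Lemma energyK t : 0 <= t -> (E t)%:E = f (u t).
Proof. by move=> t0; rewrite /E /energy fineK// fin_numElt f_gtNy CMS_dom. Qed.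

Lemma CMS_energy_ni s t : 0 <= s -> s <= t -> E t <= E s.
Proof.
move=> s0 st; have t0 := le_trans s0 st; have [_ _ fu _] := uC.
by rewrite -lee_fin !energyK// fu//; exact: ico0y.
Qed.

Lemma CMS_ac T : exists m : R -> R,
  [/\ forall r, 0 <= m r, mu.-integrable `[0, T] (EFin \o m) &
      forall s t, 0 <= s -> s <= t -> t <= T ->
        mdist (u s) (u t) <= \int[mu]_(r in `[s, t]) m r].
Proof.
have [[m [mi um]] _ _ _] := uC.
have mT : mu.-integrable `[0, T] (EFin \o m).
  apply: mi; last exact: segment_compact.
  by move=> t; rewrite /= in_itv/= => /andP[t0 _]; exact: ico0y.
exists (fun r => `|m r|); split => //.
  by move: mT => /integrable_norm; rewrite /comp/=.
move=> s t s0 st tT.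
have mst : mu.-integrable `[s, t] (EFin \o m) by exact: integrable_subitv mT.
apply: le_trans (le_normr_Rintegral _ mst); last by [].
apply: le_trans (ler_norm _).
rewrite -lee_fin /Rintegral fineK; last exact: integrable_fin_num.
by apply: um => //; apply: ico0y => //; exact: le_trans st.
Qed.

(** Stated for times in [[0, +oo[] only, since nothing is known about the curve
   at negative times. *)
Lemma CMS_continuous t e : 0 <= t -> 0 < e ->
  exists2 d, 0 < d & forall t', 0 <= t' -> `|t' - t| < d -> mdist (u t) (u t') < e.
Proof.
move=> t0 e0; have [m [m0 mi um]] := CMS_ac (t + 1).
have [d d0 dP] := Rintegral_small mi e0.
exists (Num.min d 1); first by rewrite lt_min d0 ltr01.
move=> t' t'0; rewrite lt_min => /andP[td t1].
have [tt'|t't] := leP t t'.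
  rewrite ger0_norm ?subr_ge0// in td t1.
  have tT : t' <= t + 1 by move: t1; lra.
  apply: le_lt_trans (um _ _ t0 tt' tT) _.
  by apply: le_lt_trans (ler_norm _) _; exact: dP.
rewrite ltr0_norm ?subr_lt0// opprB in td.
have tT : t <= t + 1 by lra.
rewrite metric_sym; apply: le_lt_trans (um _ _ t'0 (ltW t't) tT) _.
by apply: le_lt_trans (ler_norm _) _; apply: dP => //; exact: ltW.
Qed.

Let slope_fin t : (local_slope f (u t) < +oo)%E -> (h t)%:E = local_slope f (u t).
Proof.
move=> st; rewrite /h fineK// ge0_fin_numE//; exact: local_slope_ge0.
Qed.

Let h0 t : 0 <= h t.
Proof. by rewrite fine_ge0// local_slope_ge0. Qed.

(** The dissipation inequality forces equality in Young's inequality, since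
   convexity makes the slope a bound on all difference quotients. *)
Lemma CMS_ae : {ae mu, forall t, 0 < t ->
  [/\ (local_slope f (u t) < +oo)%E, deriv_at E t (- (h t `^ q)) &
      mderiv_at u t (h t `^ (q - 1))]}.
Proof.
have [_ pq] := conj_exponentE p1; rewrite -/q in pq.
have p00 : 0 < p by rewrite (lt_trans ltr01).
have q0 : 0 < q by rewrite (lt_trans ltr01).
have [_ _ _] := uC; apply: ae_imply => t + t0; move=> /(_ (ico0y (ltW t0))).
move=> [dE cL ineq].
set L := metric_derivative u t in ineq.
have mL : mderiv_at u t L by apply/mderiv_atP; exact: cL.
have L0 : 0 <= L.
  apply: limr_ge => //; apply: nearW => s.
  by rewrite divr_ge0// mdist_ge0.
have sfin : (local_slope f (u t) < +oo)%E.
  rewrite ltNge leye_eq; apply/negP => /eqP sy; move: ineq.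
  by rewrite sy -/q poweRyr ?gt_eqF// gt0_muley ?lte_fin ?invr_gt0// addeNy leeNy_eq.
have dE' := deriv_at_derivable dE.
set E' := derive1 _ _ in ineq dE'.
have ineq' : E' <= - (p^-1 * L `^ p) - q^-1 * h t `^ q.
  move: ineq; rewrite -slope_fin// -/q poweR_EFin -EFinM -EFinN -EFinB lee_fin.
have Eh : - E' <= h t * L.
  apply/ler_addgt0Pr => e e0.
  pose e1 := e / (1 + h t).
  have h1 : 0 < 1 + h t by rewrite ltr_pwDl.
  have e10 : 0 < e1 by rewrite divr_gt0.
  have -> : e = e1 + h t * e1 by rewrite /e1; field; rewrite gt_eqF.
  near t^'+ => s.
  have ts : t < s by near: s; exact: nbhs_right_gt.
  have st0 : 0 < s - t by rewrite subr_gt0.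
  have H1 : `|E s - E t - E' * (s - t)| <= e1 * `|s - t|.
    by near: s; apply: near_right_of_near; exact: dE'.
  have H2 : `|mdist (u t) (u s) - L * `|s - t| | <= e1 * `|s - t|.
    by near: s; apply: near_right_of_near; exact: mL.
  have s0 : 0 <= s by rewrite ltW// (lt_trans t0).
  have H3 : E t - E s <= h t * mdist (u t) (u s).
    apply: (local_slope_ge f_gtNy f_convex); rewrite ?CMS_dom ?(ltW t0)//.
    by rewrite slope_fin.
  rewrite !(gtr0_norm st0) in H1 H2.
  have {}H1 : - E' * (s - t) - e1 * (s - t) <= E t - E s.
    by have := le_trans (ler_norm _) H1; lra.
  have {}H2 : mdist (u t) (u s) <= (L + e1) * (s - t).
    have := le_trans (ler_norm _) H2; lra.
  rewrite -(ler_pM2r st0).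
  have : h t * mdist (u t) (u s) <= h t * ((L + e1) * (s - t)) by rewrite ler_wpM2l.
  lra.
have Lh : L = h t `^ (q - 1).
  apply: (@young_eq R p q) => //.
  by rewrite mulrC; move: ineq' Eh; lra.
split => //; last by rewrite -Lh.
suff -> : - (h t `^ q) = E' by [].
have hL : h t * L = h t `^ q by rewrite Lh mulr_powRB1.
have Lp : L `^ p = h t `^ q.
  by rewrite Lh -powRrM (@conj_exponent_mul _ p q)// gt_eqF.
apply/eqP; rewrite eq_le; apply/andP; split; first by move: Eh; rewrite hL; lra.
apply: le_trans ineq' _; rewrite Lp.
have : (p^-1 + q^-1) * h t `^ q = h t `^ q by rewrite pq mul1r.
lra.
Unshelve. all: end_near. Qed.

End maximal_slope.

(** * The slope along a curve of maximal slope *)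

Section slope_along_flow.
Context {R : realType} {S : completeMetricType R}.
Notation mu := (@lebesgue_measure R).
Variable f : S -> \bar R.
Hypothesis f_gtNy : forall v, (-oo < f v)%E.
Variable p0 : R.
Hypothesis f_convex : plambda_convex p0 0 f.
Variables (p : R) (u0 : S) (u : R -> S).
Hypotheses (p1 : 1 < p) (u0f : effective_domain f u0) (uC : CMS f p +oo%E u0 u).

Let q := conj_exponent p.
Let E := energy f u.
Let h t := fine (local_slope f (u t)).

Let q1 : 1 < q. Proof. exact: (conj_exponentE p1).1. Qed.
Let q10 : 0 < q - 1. Proof. by rewrite subr_gt0. Qed.

Let slope_fin t : (local_slope f (u t) < +oo)%E -> (h t)%:E = local_slope f (u t).
Proof.
move=> st; rewrite /h fineK// ge0_fin_numE//; exact: local_slope_ge0.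
Qed.

Let h0 t : 0 <= h t.
Proof. by rewrite fine_ge0// local_slope_ge0. Qed.

Let dom (t : R) : 0 <= t -> (f (u t) < +oo)%E. Proof. exact: (CMS_dom u0f uC). Qed.

(** For a competitor [w] below the final energy, the quotient
   [(E r - f w) / d (u r) w] decreases in time: the energy drops at rate
   [h * |u'|], while the distance to [w] shrinks at rate at most [|u'|], and the
   quotient is itself at most [h]. *)
Lemma CMS_quotient_ni (w : S) s t : 0 <= s -> s <= t ->
  (f w < +oo)%E -> fine (f w) < E t ->
  (E t - fine (f w)) / mdist (u t) w <= (E s - fine (f w)) / mdist (u s) w.
Proof.
move=> s0 st fw Et; set k := fine (f w) in Et *.
have t0 := le_trans s0 st.
pose D r := mdist (u r) w.
have Ek r : s <= r <= t -> k < E r.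
  move=> /andP[sr rt]; apply: lt_le_trans Et _.
  exact: (CMS_energy_ni f_gtNy u0f uC (le_trans s0 sr) rt).
have D0 r : s <= r <= t -> 0 < D r.
  move=> /Ek kE; rewrite /D mdist_gt0; apply: contraTneq kE => rw.
  by rewrite /k /E /energy rw ltxx.
have DB x y : D x - D y <= mdist (u x) (u y).
  by rewrite /D metric_sym (metric_sym (u y)) (metric_sym (u x) (u y)) mdist_sub_le.
(* A positive lower bound on the distance to [w] turns the bound on the
   increments of [u] into one on the increments of the quotient. *)
have [c cst cD] : exists2 c, c \in `[s, t] & forall r, r \in `[s, t] -> D c <= D r.
  apply: EVT_min => //; apply/subspace_continuousP => r.
  rewrite /= in_itv/= => /andP[sr rt].
  apply/cvgrPdist_lt => e e0; rewrite near_withinE.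
  have r0 := le_trans s0 sr.
  have [d d0 dP] := CMS_continuous uC r0 e0.
  apply/nbhs_ballP; exists d => //= y; rewrite /ball/= => ryd.
  rewrite in_itv/= => /andP[sy yt].
  have y0 := le_trans s0 sy.
  have ruy : mdist (u r) (u y) < e by apply: dP => //; rewrite distrC.
  rewrite ltr_norml ltrNl opprB (le_lt_trans (DB r y) ruy) andbT.
  by apply: le_lt_trans ruy; rewrite metric_sym DB.
rewrite in_itv/= in cst.
have Dc0 := D0 _ cst.
have Dc r : s <= r <= t -> D c <= D r by move=> rst; apply: cD; rewrite in_itv.
have [m [m0 mi um]] := CMS_ac uC t.
have mst : mu.-integrable `[s, t] (EFin \o m) by exact: integrable_subitv mi.
pose K := (E s - k) / (D c * D c).
have K0 : 0 <= K.
  rewrite divr_ge0 ?mulr_ge0 ?(ltW Dc0)// subr_ge0 ltW//.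
  by apply: Ek; rewrite lexx.
have DD x y : s <= x <= t -> s <= y <= t -> D c * D c <= D x * D y.
  by move=> xst yst; apply: ler_pM; rewrite ?(ltW Dc0)// Dc.
have quot x y : s <= x <= t -> s <= y <= t ->
    (E y - k) / D y - (E x - k) / D x =
    ((E y - E x) * D x + (E x - k) * (D x - D y)) / (D x * D y).
  by move=> /D0 Dx /D0 Dy; field; rewrite !gt_eqF.
have KmE x y : s <= x -> x <= y -> y <= t ->
    \int[mu]_(r in `[x, y]) (K * m r) = K * \int[mu]_(r in `[x, y]) m r.
  move=> sx xy yt; rewrite RintegralZl//.
  exact: integrable_subitv mst.
apply: (@nonincreasing_of_dini R (fun r => (E r - k) / D r) (fun r => K * m r)) => //.
- have := @integrableZl _ _ _ mu _ (measurable_itv `[s, t]) K _ mst.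
  by apply: eq_integrable => // r _; rewrite /= EFinM.
- by move=> r; rewrite mulr_ge0.
- move=> x y sx xy yt; rewrite KmE//.
  have xst : s <= x <= t by rewrite sx (le_trans xy).
  have yst : s <= y <= t by rewrite yt (le_trans sx).
  have umxy : mdist (u x) (u y) <= \int[mu]_(r in `[x, y]) m r.
    by apply: um => //; exact: le_trans sx.
  have i0 : 0 <= \int[mu]_(r in `[x, y]) m r by exact: Rintegral_ge0.
  rewrite quot// ler_pdivrMr ?mulr_gt0 ?D0//.
  apply: (@le_trans _ _ ((E x - k) * \int[mu]_(r in `[x, y]) m r)).
    rewrite -[leRHS]add0r lerD//.
      rewrite mulr_le0_ge0 ?(ltW (D0 _ _))// subr_le0.
      exact: (CMS_energy_ni f_gtNy u0f uC (le_trans s0 sx) xy).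
    by rewrite ler_wpM2l ?(le_trans (DB _ _))// subr_ge0 ltW// Ek.
  apply: (@le_trans _ _ ((E s - k) * \int[mu]_(r in `[x, y]) m r)).
    by rewrite ler_wpM2r// lerD2r; exact: (CMS_energy_ni f_gtNy u0f uC s0 sx).
  rewrite mulrAC ler_wpM2r// /K -mulrA ler_peMr//.
    by rewrite subr_ge0 ltW// Ek// lexx.
  by rewrite mulrC ler_pdivlMr ?mulr_gt0// mul1r DD.
apply: ae_imply (CMS_ae f_gtNy f_convex p1 u0f uC) => x aex /andP[sx xt] e e0.
have x0 : 0 < x by rewrite (le_lt_trans s0).
have [sfin dE mL] := aex x0.
have xst : s <= x <= t by rewrite !ltW.
rewrite -/E -/q -/(h x) in dE mL.
have Exk : 0 < E x - k by rewrite subr_gt0 Ek.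
have Dx0 := D0 _ xst.
have den : 0 < D x + (E x - k) by rewrite addr_gt0.
pose e1 := e * (D c * D c) / (D x + (E x - k)).
have e10 : 0 < e1 by rewrite divr_gt0// !mulr_gt0.
near=> y.
have xy : x < y by near: y; exact: nbhs_right_gt.
have yt : y <= t by near: y; exact: nbhs_right_le.
have yst : s <= y <= t by rewrite yt (le_trans (ltW sx) (ltW xy)).
have yx0 : 0 < y - x by rewrite subr_gt0.
have H1 : `|E y - E x - - (h x `^ q) * (y - x)| <= e1 * `|y - x|.
  by near: y; apply: near_right_of_near; exact: dE.
have H2 : `|mdist (u x) (u y) - h x `^ (q - 1) * `|y - x| | <= e1 * `|y - x|.
  by near: y; apply: near_right_of_near; exact: mL.
rewrite !(gtr0_norm yx0) in H1 H2.
have {H1} H1 := le_trans (ler_norm _) H1.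
have {H2} H2 := le_trans (ler_norm _) H2.
have H3 : E x - k <= h x * D x.
  apply: (local_slope_ge f_gtNy f_convex) => //; first by apply: dom; exact: ltW.
  by rewrite slope_fin.
have H4 : (E x - k) * h x `^ (q - 1) <= h x `^ q * D x.
  rewrite -(@mulr_powRB1 _ _ q) ?(lt_trans ltr01)// mulrAC.
  by rewrite ler_wpM2r ?powR_ge0.
rewrite quot// ler_pdivrMr ?mulr_gt0 ?D0//.
apply: (@le_trans _ _ (e * (y - x) * (D c * D c))); last first.
  by rewrite ler_pM2l ?mulr_gt0// DD.
have -> : e * (y - x) * (D c * D c) = e1 * (D x + (E x - k)) * (y - x).
  by rewrite /e1 divfK ?gt_eqF// mulrAC.
have H5 : (E y - E x) * D x <= (e1 - h x `^ q) * (y - x) * D x.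
  by rewrite ler_pM2r//; move: H1; lra.
have H6 : (E x - k) * (D x - D y) <= (E x - k) * ((h x `^ (q - 1) + e1) * (y - x)).
  rewrite ler_pM2l// (le_trans (DB _ _))//; move: H2; lra.
have H7 : (E x - k) * h x `^ (q - 1) * (y - x) <= h x `^ q * D x * (y - x).
  by rewrite ler_pM2r.
move: H5 H6 H7.
set A := h x `^ q; set B := h x `^ (q - 1).
set dE' := (_ - _) * D x; set dD := (_ - k) * (_ - _).
clear -R; lra.
Unshelve. all: end_near. Qed.

(** The slope is the supremum of the quotients over all competitors, each of
   which decreases in time. *)
Lemma CMS_slope_ni s t : 0 <= s -> s <= t ->
  (local_slope f (u t) <= local_slope f (u s))%E.
Proof.
move=> s0 st; have t0 := le_trans s0 st.
have [sy|] := boolP (local_slope f (u s) < +oo)%E; last first.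
  by rewrite -leNgt leye_eq => /eqP ->; rewrite leey.
rewrite -(slope_fin sy); apply: local_slope_le => //; first exact: dom.
move=> w fw; rewrite -/(E t); have [Ew|wE] := leP (E t) (fine (f w)).
  apply: (@le_trans _ _ 0); first by rewrite subr_le0.
  by rewrite mulr_ge0// mdist_ge0.
have pos r : s <= r <= t -> 0 < mdist (u r) w.
  move=> /andP[sr rt]; rewrite mdist_gt0; apply: contraTneq wE => rw.
  rewrite -leNgt (@le_trans _ _ (E r))//; first exact: (CMS_energy_ni f_gtNy u0f uC (le_trans s0 sr) rt).
  by rewrite /E /energy rw.
have tt : s <= t <= t by rewrite st lexx.
have ss : s <= s <= t by rewrite st lexx.
rewrite -ler_pdivrMr ?pos//; apply: le_trans (CMS_quotient_ni s0 st fw wE) _.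
rewrite ler_pdivrMr ?pos//; apply: (local_slope_ge f_gtNy f_convex) => //.
  exact: dom.
by rewrite slope_fin.
Qed.

(** The slope is finite at almost every time, and it can only decrease. *)
Lemma CMS_slope_lty t : 0 < t -> (local_slope f (u t) < +oo)%E.
Proof.
move=> t0; rewrite ltNge leye_eq; apply/negP => /eqP sy.
have [N [mN N0 PN]] := CMS_ae f_gtNy f_convex p1 u0f uC.
have : `](0:R), t] `<=` N.
  move=> x; rewrite /= in_itv/= => /andP[x0 xt]; apply: PN => /= /(_ x0)[+ _ _].
  have := CMS_slope_ni (ltW x0) xt; rewrite sy leye_eq => /eqP ->.
  by rewrite ltxx.
move=> tN; have : (mu `]0%R, t] <= mu N)%E by apply: le_measure; rewrite ?inE.
by rewrite [X in (_ <= X)%E]N0 lebesgue_measure_itv/= lte_fin t0 -EFinB lee_fin subr0 leNgt t0.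
Qed.

(** The metric speed is [h^(q-1)] almost everywhere, so that any integrable
   majorant of this function bounds distances along the curve. *)
Lemma CMS_length_le (W : R -> R) a b : 0 <= a -> a <= b ->
  mu.-integrable `[a, b] (EFin \o W) ->
  (forall r, a < r < b -> h r `^ (q - 1) <= W r) ->
  mdist (u a) (u b) <= \int[mu]_(r in `[a, b]) W r.
Proof.
move=> a0 ab Wi hW; have [m [m0 mi um]] := CMS_ac uC b.
have mab : mu.-integrable `[a, b] (EFin \o m) by exact: integrable_subitv mi.
have nWi : mu.-integrable `[a, b] (EFin \o (fun r => `|W r|)).
  by move: Wi => /integrable_norm; rewrite /comp/=.
suff : mdist (u a) (u b) - \int[mu]_(r in `[a, b]) W r <=
       mdist (u a) (u a) - \int[mu]_(r in `[a, a]) W r.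
  by rewrite mdistxx set_itv1 Rintegral_set1 subrr subr_le0.
apply: (@nonincreasing_of_dini R
  (fun x => mdist (u a) (u x) - \int[mu]_(r in `[a, x]) W r)
  (fun r => m r + `|W r|)) => //.
- by apply: (@integrableD _ _ _ mu _ _ (EFin \o m) (EFin \o (fun r => `|W r|))).
- by move=> r; rewrite addr_ge0.
- move=> x y ax xy yb.
  have Wxy : mu.-integrable `[x, y] (EFin \o W) by exact: integrable_subitv Wi.
  have Way : mu.-integrable `[a, y] (EFin \o W) by exact: integrable_subitv Wi.
  rewrite RintegralD//; [|exact: integrable_subitv mab|exact: integrable_subitv nWi].
  have := mdist_sub_le (u a) (u x) (u y).
  have := um _ _ (le_trans a0 ax) xy yb.
  rewrite (Rintegral_chasles ax xy Way).
  have : 0 - \int[mu]_(r in `[x, y]) W r <= \int[mu]_(r in `[x, y]) `|W r|.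
    rewrite sub0r; apply: le_trans (le_normr_Rintegral _ Wxy); last by [].
    by rewrite -normrN ler_norm.
  by lra.
have := ae_and (CMS_ae f_gtNy f_convex p1 u0f uC) (ae_deriv_integral ab Wi).
apply: ae_imply => x [aex Wx] axb e e0.
have {}Wx := Wx axb; move: axb => /andP[ax xb].
have x0 : 0 < x by rewrite (le_lt_trans a0).
have [sfin _ mL] := aex x0; rewrite -/q -/(h x) in mL.
have e20 : 0 < e / 2 by rewrite divr_gt0.
near=> y.
have xy : x < y by near: y; exact: nbhs_right_gt.
have yx0 : 0 < y - x by rewrite subr_gt0.
have H2 : `|mdist (u x) (u y) - h x `^ (q - 1) * `|y - x| | <= e / 2 * `|y - x|.
  by near: y; apply: near_right_of_near; exact: mL.
have H1 : `|\int[mu]_(r in `[a, y]) W r - \int[mu]_(r in `[a, x]) W r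
   - W x * (y - x)| <= e / 2 * `|y - x|.
  by near: y; apply: near_right_of_near; exact: Wx.
rewrite !(gtr0_norm yx0) in H1 H2.
have {H2} H2 := le_trans (ler_norm _) H2.
move: H1; rewrite ler_norml => /andP[H1 _].
have H3 : h x `^ (q - 1) * (y - x) <= W x * (y - x).
  by rewrite ler_pM2r// hW// ax.
have := mdist_sub_le (u a) (u x) (u y).
by lra.
Unshelve. all: end_near. Qed.

Lemma CMS_stationary s t : 0 <= s -> s <= t -> local_slope f (u s) = 0%E ->
  u t = u s.
Proof.
move=> s0 st us; apply/esym/mdist_positivity/eqP.
rewrite eq_le mdist_ge0 andbT.
have i0 : mu.-integrable `[s, t] (EFin \o cst (0 : R)).
  by apply: (@integrable_bounded_itv _ _ _ _ 0) => //= r _; rewrite lexx.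
apply: le_trans (CMS_length_le s0 st i0 _) _.
  move=> r /andP[sr rt]; have := CMS_slope_ni s0 (ltW sr).
  rewrite us => H; have /eqP : local_slope f (u r) == 0%E.
    by rewrite eq_le H local_slope_ge0.
  by rewrite /h => -> /=; rewrite powR0// gt_eqF.
by rewrite (Rintegral_itv_cst 0 st) mul0r.
Qed.

End slope_along_flow.

(** * Clocks with a monotone rate *)

Section powR_bounds.
Context {R : realType}.
Implicit Types x y z al : R.

(** Covers both signs of [al], for which the power is monotone in opposite
   directions. *)
Lemma powR_between x y z al : 0 < x -> x <= y -> y <= z ->
  Num.min (x `^ al) (z `^ al) <= y `^ al <= Num.max (x `^ al) (z `^ al).
Proof.
move=> x0 xy yz; have y0 := lt_le_trans x0 xy; have z0 := lt_le_trans y0 yz.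
have mono (b a c : R) : 0 <= b -> 0 < a -> a <= c -> a `^ b <= c `^ b.
  by move=> b0 a0 ac; apply: ge0_ler_powR; rewrite // nnegrE ltW// (lt_le_trans a0).
have [al0|al0] := leP 0 al.
  by rewrite ge_min le_max (mono al x y)// (mono al y z)// orbT.
have anti (a c : R) : 0 < a -> a <= c -> c `^ al <= a `^ al.
  move=> a0 ac; rewrite -(opprK al) !(powRN _ (- al)).
  by rewrite lef_pV2 ?posrE ?powR_gt0// ?(lt_le_trans a0)// mono// oppr_ge0 ltW.
by rewrite ge_min le_max (anti x y)// (anti y z)// orbT.
Qed.

(** Below [be], the only obstruction to bounding [x `^ al] by [x `^ be] is at
   small [x] with a negative exponent, hence the reference value [d]. *)
Lemma powR_le_add x d al be : 0 <= x -> 0 < d -> x = 0 \/ d <= x ->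
  al <= be -> 0 <= be -> x `^ al <= d `^ al + 1 + x `^ be.
Proof.
move=> x0 d0 xd ab be0.
have da := powR_ge0 d al; have xb := powR_ge0 x be.
case: xd => [->|dx].
  rewrite -lerBlDr; apply: (@le_trans _ _ 1).
    rewrite (@le_trans _ _ (0 `^ al))//; first by rewrite gerBl powR_ge0.
    have [->|a0] := eqVneq al 0; first by rewrite powRr0.
    by rewrite powR0.
  by rewrite lerDr.
have x0' := lt_le_trans d0 dx.
have [x1|x1] := leP 1 x.
  have : x `^ al <= x `^ be by exact: ler_powR.
  lra.
have /andP[_ H] := powR_between al d0 dx (ltW x1).
rewrite (le_trans H)// powR1 ge_max; apply/andP; split; lra.
Qed.

End powR_bounds.

Section ae_exhaust.
Context {R : realType}.
Notation mu := (@lebesgue_measure R).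

(** The set [Q] may be uncountable: a rational number between [x] and [b] reduces
   the statement to countably many bounds. *)
Lemma ae_exhaust (Q : set R) (G : R -> Prop) :
  (forall b, Q b -> {ae mu, forall x, x < b -> G x}) ->
  {ae mu, forall x, (exists2 b, Q b & x < b) -> G x}.
Proof.
move=> QG.
pose r n : R := if @unpickle rat n is Some a then ratr a else 0.
have : {ae mu, forall x n, (exists2 b, Q b & r n < b) -> x < r n -> G x}.
  apply/ae_foralln => n; have [[b Qb rb]|nQ] := pselect (exists2 b, Q b & r n < b).
    by apply: ae_imply (QG b Qb) => x Gx _ xr; apply: Gx; exact: lt_trans rb.
  by apply: aeW => x /=.
apply: ae_imply => x H [b Qb xb].
have [a] := rat_in_itvoo xb; rewrite in_itv/= => /andP[xa ab].
apply: (H (pickle a)); rewrite /r pickleK//.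
by exists b.
Qed.

End ae_exhaust.


Section clock.
Context {R : realType}.
Notation mu := (@lebesgue_measure R).

Definition clock (h : R -> R) (al t : R) : R :=
  \int[mu]_(r in `[0, t]) (h r `^ al).

(** The inverse of the clock, capped at the end of the period [P]. *)
Definition time_change (P : set R) (h : R -> R) (al s : R) : \bar R :=
  maxe 0%E (ereal_sup [set t%:E | t in [set t | P t /\ clock h al t <= s]]).

Definition end_time (P : set R) : \bar R :=
  maxe 0%E (ereal_sup [set t%:E | t in P]).

Lemma time_change_ext (P Q : set R) (h k : R -> R) al s :
  (forall t, 0 <= t -> h t = k t) -> P = Q ->
  time_change P h al s = time_change Q k al s.
Proof.
move=> hk ->.
have cl t : clock h al t = clock k al t.
  by apply: eq_Rintegral => r; rewrite inE/= in_itv/= => /andP[r0 _]; rewrite hk.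
pose G (X : set R) : \bar R := maxe 0%E (ereal_sup (EFin @` X)).
apply: (congr1 G).
apply/seteqP; split => t /= [Qt ts]; (split; first exact: Qt).
  by rewrite -cl.
by rewrite cl.
Qed.

(** What the time change needs to know about a flow: [P] is the period of
   activity, an interval [0, T) that may be empty or unbounded, and [h] the rate
   on it. *)
Record clockable (P : set R) (h : R -> R) (al : R) : Prop := Clockable {
  period_ge0 : forall t, P t -> 0 <= t;
  period_down : forall s t, P t -> 0 <= s -> s <= t -> P s;
  period_open : forall t, P t -> exists2 t', t < t' & P t';
  rate_ni : forall x y, 0 < x -> x <= y -> h y <= h x;
  rate_gt0 : forall t, P t -> 0 < t -> 0 < h t;
  rate_int : forall b, P b ->
    mu.-integrable `[0, b] (EFin \o (fun r => h r `^ al)) }.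

Variables (P : set R) (h : R -> R) (al : R).
Hypothesis D : clockable P h al.

Let P_ge0 := period_ge0 D.
Let P_down := period_down D.
Let P_open := period_open D.
Let h_ni := rate_ni D.
Let h_gt0 := rate_gt0 D.
Let h_int := rate_int D.

Local Notation sg := (clock h al).

Lemma clock0 : sg 0 = 0.
Proof. by rewrite /clock set_itv1 Rintegral_set1. Qed.

Lemma clockB a b : P b -> 0 <= a -> a <= b ->
  sg b = sg a + \int[mu]_(r in `[a, b]) (h r `^ al).
Proof. by move=> Pb a0 ab; apply: Rintegral_chasles => //; exact: h_int. Qed.

(** On an interval away from [0] and from the end of the period, the rate is
   between two positive constants because [h] is monotone. *)
Lemma clock_rate a b : P b -> 0 < a -> a <= b ->
  exists c C, [/\ 0 < c, 0 < C & forall x y, a <= x -> x <= y -> y <= b ->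
    c * (y - x) <= sg y - sg x <= C * (y - x)].
Proof.
move=> Pb a0 ab; have hb := h_gt0 Pb (lt_le_trans a0 ab).
have ha : 0 < h a := lt_le_trans hb (h_ni a0 ab).
exists (Num.min (h b `^ al) (h a `^ al)), (Num.max (h b `^ al) (h a `^ al)).
have hba := powR_gt0 al hb; have haa := powR_gt0 al ha.
split.
- rewrite lt_min.
  rewrite hba.
  rewrite haa.
  by [].
- rewrite lt_max.
  rewrite hba.
  by [].
move=> x y ax xy yb.
have x0 : 0 <= x by rewrite (le_trans (ltW a0)).
have Py : P y by apply: P_down Pb _ yb; exact: le_trans xy.
have ixy : mu.-integrable `[x, y] (EFin \o (fun r => h r `^ al)).
  by apply: integrable_subitv (h_int Py).
rewrite (clockB Py x0 xy) addrAC subrr add0r.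
have bd r : x <= r <= y ->
    Num.min (h b `^ al) (h a `^ al) <= h r `^ al <= Num.max (h b `^ al) (h a `^ al).
  move=> /andP[xr ry]; apply: powR_between => //; apply: h_ni => //.
  - by rewrite (lt_le_trans a0)// (le_trans ax).
  - exact: le_trans yb.
  - exact: le_trans xr.
apply/andP; split.
  by apply: Rintegral_ge_cst => // r /bd/andP[].
by apply: Rintegral_le_cst => // r /bd/andP[].
Qed.

Lemma clock_le a b : P b -> 0 <= a -> a <= b -> sg a <= sg b.
Proof.
move=> Pb a0 ab; rewrite (clockB Pb a0 ab) lerDl Rintegral_ge0// => r _.
exact: powR_ge0.
Qed.

Lemma clock_lt a b : P b -> 0 <= a -> a < b -> sg a < sg b.
Proof.
move=> Pb a0 ab; pose c := (a + b) / 2.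
have ac : a < c by rewrite /c; lra.
have cb : c < b by rewrite /c; lra.
have c0 : 0 < c by rewrite (le_lt_trans a0).
have Pc : P c by apply: P_down Pb _ (ltW cb); exact: ltW.
apply: le_lt_trans (clock_le Pc a0 (ltW ac)) _.
have [k [C [k0 _ kC]]] := clock_rate Pb c0 (ltW cb).
have /andP[H _] := kC c b (lexx _) (ltW cb) (lexx _).
by rewrite -subr_gt0 (lt_le_trans _ H)// mulr_gt0// subr_gt0.
Qed.

Lemma clock_le_mono a b : P a -> P b -> (sg a <= sg b) = (a <= b).
Proof.
move=> Pa Pb; have [ab|ba] := leP a b; first by apply: clock_le => //; exact: P_ge0 Pa.
by apply/negbTE; rewrite -ltNge; apply: clock_lt => //; exact: (P_ge0 Pb).
Qed.

Lemma clock_uniform_continuous b e : P b -> 0 < e -> exists2 d, 0 < d &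
  forall x y, 0 <= x -> x <= y -> y <= b -> y - x < d -> sg y - sg x < e.
Proof.
move=> Pb e0; have [d d0 dP] := Rintegral_small (h_int Pb) e0.
exists d => // x y x0 xy yb yx.
have Py : P y by apply: P_down Pb _ yb; exact: le_trans xy.
rewrite (clockB Py x0 xy) addrAC subrr add0r.
by rewrite (le_lt_trans (ler_norm _))// dP.
Qed.

Lemma clock_small b e : P b -> 0 < e -> exists2 d, 0 < d &
  forall y, 0 <= y -> y <= b -> y < d -> sg y < e.
Proof.
move=> Pb e0; have [d d0 dP] := clock_uniform_continuous Pb e0.
exists d => // y y0 yb yd.
by have := dP 0 y (lexx 0) y0 yb; rewrite subr0 clock0 subr0; exact.
Qed.

Lemma clock_ivt b s : P b -> 0 <= s -> s <= sg b -> exists2 t, P t & sg t = s.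
Proof.
move=> Pb s0 sb; have b0 := (P_ge0 Pb).
have := @IVT _ sg 0 b s b0.
have cts : {within `[0, b], continuous sg}.
  exact: (parameterized_integral_continuous b0 (h_int Pb)).
have sb0 : sg 0 <= sg b by rewrite clock_le// lexx.
move=> /(_ cts); rewrite clock0 in sb0 *; rewrite min_l// max_r// s0 sb.
move=> /(_ isT)[t]; rewrite in_itv/= => /andP[t0 tb] ts.
by exists t => //; exact: P_down Pb t0 tb.
Qed.

(** Each bound [b] in the period gives the derivative almost everywhere before
   [b]. *)
Lemma clock_deriv : {ae mu, forall t, 0 < t -> P t -> deriv_at sg t (h t `^ al)}.
Proof.
have : {ae mu, forall t, (exists2 b, P b & t < b) -> 0 < t -> deriv_at sg t (h t `^ al)}.
  apply: ae_exhaust => b Pb.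
  apply: ae_imply (ae_deriv_integral (P_ge0 Pb) (h_int Pb)) => x H xb x0.
  by apply: H; rewrite x0 xb.
apply: ae_imply => t H t0 Pt; apply: H => //.
by have [b tb Pb] := P_open Pt; exists b.
Qed.

End clock.

(** * The active period of a curve of maximal slope *)

Section flow_data.
Context {R : realType} {S : metricType R}.
Implicit Types (f : S -> \bar R) (u : R -> S).

Definition slope_along f u (t : R) : R := fine (local_slope f (u t)).

Definition active f u : set R := [set t | 0 <= t /\ (0 < local_slope f (u t))%E].

Lemma activeI f u t : 0 <= t -> (0 < local_slope f (u t))%E -> active f u t.
Proof. by []. Qed.

Lemma inactive_slope f u t : 0 <= t -> ~ active f u t -> local_slope f (u t) = 0%E.
Proof.
move=> t0 nPt; apply/eqP; rewrite eq_le local_slope_ge0 andbT leNgt.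
by apply/negP => /(activeI t0).
Qed.

Lemma end_time_le_Tstar f u : (end_time (active f u) <= Tstar f +oo u)%E.
Proof.
rewrite /end_time /Tstar ge_max le_max lexx/= le_max; apply/orP; right.
by apply: ereal_sup_le => _ [t [t0 ut] <-]; exists t => //; split=> //; split => //; exact: ltry.
Qed.

End flow_data.

Section active_period.
Context {R : realType} {S : completeMetricType R}.
Notation mu := (@lebesgue_measure R).
Variable f : S -> \bar R.
Hypothesis f_gtNy : forall v, (-oo < f v)%E.
Variable p0 : R.
Hypothesis f_convex : plambda_convex p0 0 f.
#[local] Opaque local_slope.
Variables (p : R) (u0 : S) (u : R -> S).
Hypotheses (p1 : 1 < p) (u0f : effective_domain f u0) (uC : CMS f p +oo%E u0 u).
Variable al : R.
Hypothesis al_le : al <= conj_exponent p.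

Let q := conj_exponent p.
Let E := energy f u.
Let h := slope_along f u.
Let P := active f u.

Let q1 : 1 < q. Proof. exact: (conj_exponentE p1).1. Qed.

Lemma slope_alongK t : 0 < t -> (h t)%:E = local_slope f (u t).
Proof.
move=> t0; rewrite /h /slope_along fineK// ge0_fin_numE ?local_slope_ge0//.
exact: CMS_slope_lty f_gtNy _ f_convex _ _ _ p1 u0f uC _ t0.
Qed.

Lemma slope_along_ge0 t : 0 <= h t.
Proof. by rewrite fine_ge0// local_slope_ge0. Qed.

(** At time [0] the slope may be infinite, in which case [slope_along] takes the
   default value [0]. *)
Lemma slope_along_at0 c : 0 < c -> h 0 = 0 \/ h c <= h 0.
Proof.
move=> c0; have [s0|s0] := boolP (local_slope f (u 0) < +oo)%E.
  right; rewrite -lee_fin slope_alongK// /h /slope_along fineK; last first.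
    by rewrite ge0_fin_numE// local_slope_ge0.
  exact: CMS_slope_ni f_gtNy _ f_convex _ _ _ p1 u0f uC _ _ (lexx 0) (ltW c0).
by left; move: s0; rewrite -leNgt leye_eq /h /slope_along => /eqP ->.
Qed.

#[local] Opaque slope_along.

Lemma slope_along_ni x y : 0 < x -> x <= y -> h y <= h x.
Proof.
move=> x0 xy; rewrite -lee_fin !slope_alongK ?(lt_le_trans x0)//.
exact: (CMS_slope_ni f_gtNy f_convex p1 u0f uC (ltW x0) xy).
Qed.

Lemma active_down s t : P t -> 0 <= s -> s <= t -> P s.
Proof.
move=> [t0 ht] s0 st; split; first exact: s0.
apply: lt_le_trans ht _.
exact: (CMS_slope_ni f_gtNy f_convex p1 u0f uC s0 st).
Qed.

Lemma slope_along_gt0 t : P t -> 0 < t -> 0 < h t.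
Proof. by move=> [_ ht] t0; rewrite -lte_fin slope_alongK//; exact: ht. Qed.

Lemma inactive_stationary s t : 0 <= s -> s <= t -> ~ P s -> u t = u s.
Proof.
move=> s0 st nPs; apply: (CMS_stationary f_gtNy f_convex p1 u0f uC s0 st).
exact: inactive_slope.
Qed.

(** If the slope vanished at all later times the curve would be constant there,
   hence equal to [u t] by continuity, where the slope is positive. *)
Lemma active_open t : P t -> exists2 t', t < t' & P t'.
Proof.
move=> [t0 ht]; apply: contrapT => H.
have nP r : t < r -> ~ P r by move=> tr Pr; apply: H; exists r.
have ut1 : u t = u (t + 1).
  apply: mdist_positivity; apply/eqP; rewrite eq_le mdist_ge0 andbT.
  apply/ler_addgt0Pl => e e0; rewrite addr0.
  have [d d0 dP] := CMS_continuous uC t0 e0.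
  pose d' := Num.min (d / 2) 1.
  have d'0 : 0 < d' by rewrite lt_min ltr01 divr_gt0.
  have d'd : d' < d by rewrite gt_min ltr_pdivrMr// ltr_pMr// ltr1n.
  have d'1 : d' <= 1 by rewrite ge_min lexx orbT.
  have td0 : 0 <= t + d' by rewrite addr_ge0// ltW.
  rewrite (@inactive_stationary (t + d') (t + 1)) ?lerD2l//; last first.
    by apply: nP; rewrite ltrDl.
  by apply/ltW/dP => //; rewrite addrAC subrr add0r gtr0_norm.
have t11 : t < t + 1 by rewrite ltrDl.
apply: (nP _ t11); split; first by rewrite ltW// (le_lt_trans t0).
by rewrite -ut1.
Qed.

Lemma slope_along_measurable (K : R) : measurable_fun `[0, K] h.
Proof.
apply/measurable_fun_itv_obnd_cbndP.
apply: measurable_funS (nonincreasing_on_measurable slope_along_ni) => //.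
exact: subset_itvl.
Qed.

(** Near [0] the rate is dominated by the dissipation [h^q], and elsewhere by its
   values on an interval where [h] is bounded away from [0]. *)
Lemma clock_integrable b : P b -> mu.-integrable `[0, b] (EFin \o (fun r => h r `^ al)).
Proof.
move=> Pb; have [c bc Pc] := active_open Pb.
have c0 : 0 < c := le_lt_trans Pb.1 bc.
suff : mu.-integrable `[0, c] (EFin \o (fun r => h r `^ al)).
  by apply: integrable_subitv => //; exact: ltW.
have hc := slope_along_gt0 Pc c0.
have iq : mu.-integrable `[0, c] (EFin \o (fun r => h r `^ q)).
  apply: (@dissipation_integrable _ E _ _ c0).
  - by move=> x; exact: powR_ge0.
  - move=> x y x0 xy; apply: ge0_ler_powR; rewrite ?nnegrE.
    + by rewrite ltW// (lt_trans ltr01).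
    + exact: slope_along_ge0.
    + exact: slope_along_ge0.
    + exact: slope_along_ni.
  - by move=> x y x0 xy; exact: (CMS_energy_ni f_gtNy u0f uC x0 xy).
  - apply: ae_imply (CMS_ae f_gtNy f_convex p1 u0f uC) => x + x0.
    by move=> /(_ x0)[].
have icst : mu.-integrable `[0, c] (EFin \o cst (h c `^ al + 1)).
  apply: (@integrable_bounded_itv _ _ _ _ (h c `^ al + 1)) => //= x _.
  by rewrite lexx addr_ge0// powR_ge0.
have isum : mu.-integrable `[0, c] (EFin \o (fun r => h c `^ al + 1 + h r `^ q)).
  have := @integrableD _ _ _ mu _ (measurable_itv _) _ _ icst iq.
  by apply: eq_integrable => // x _.
apply: le_integrable isum => //.
  apply/measurable_EFinP; apply: (measurableT_comp (measurable_powR al)).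
  exact: slope_along_measurable.
move=> r; rewrite /= in_itv/= => /andP[r0 rc].
have sum0 : 0 <= h c `^ al + 1 + h r `^ q by rewrite !addr_ge0 ?powR_ge0.
rewrite lee_fin !ger0_norm ?powR_ge0//.
apply: powR_le_add => //; [exact: slope_along_ge0| |by rewrite ltW// (lt_trans ltr01)].
move: r0; rewrite le_eqVlt => /predU1P[<-|r0]; last by right; exact: slope_along_ni.
exact: slope_along_at0.
Qed.

Lemma active_clockable : clockable P h al.
Proof.
split.
- by move=> t [].
- exact: active_down.
- exact: active_open.
- exact: slope_along_ni.
- exact: slope_along_gt0.
- exact: clock_integrable.
Qed.

End active_period.

(** * The time change *)

Section time_change.
Context {R : realType}.
Variables (P : set R) (h : R -> R) (al : R).
Hypothesis D : clockable P h al.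

Local Notation sg := (clock h al).
Local Notation tc := (time_change P h al).

Lemma active_lt_end t : 0 <= t -> P t <-> (t%:E < end_time P)%E.
Proof.
move=> t0; split=> [Pt|].
  have [t' tt' Pt'] := period_open D Pt.
  rewrite /end_time lt_max; apply/orP; right.
  rewrite (@lt_le_trans _ _ t'%:E) ?lte_fin//.
  by apply: ereal_sup_ubound; exists t'.
rewrite /end_time lt_max => /orP[|/ereal_sup_gt[_ [t' Pt' <-]]].
  by rewrite lte_fin ltNge t0.
by rewrite lte_fin => tt'; apply: (period_down D Pt') => //; exact: ltW.
Qed.

Lemma time_change_ge0 s : (0 <= tc s)%E.
Proof. by rewrite le_max lexx. Qed.

Lemma time_change_le_end s : (tc s <= end_time P)%E.
Proof.
rewrite /time_change ge_max {1}/end_time le_max lexx/=.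
rewrite /end_time le_max; apply/orP; right.
by apply: ereal_sup_le => _ [t [Pt _] <-]; exists t.
Qed.

Lemma time_change_mono s s' : s <= s' -> (tc s <= tc s')%E.
Proof.
move=> ss'; rewrite /time_change ge_max le_max lexx/=.
rewrite le_max; apply/orP; right.
apply: ereal_sup_le => _ [t [Pt ts] <-]; exists t => //.
by split => //; exact: le_trans ss'.
Qed.

Lemma time_change_lb t s : P t -> sg t <= s -> (t%:E <= tc s)%E.
Proof.
move=> Pt ts; rewrite /time_change le_max; apply/orP; right.
by apply: ereal_sup_ubound; exists t.
Qed.

Lemma time_change_ub (T s : R) : 0 <= T ->
  (forall t, P t -> sg t <= s -> t <= T) -> (tc s <= T%:E)%E.
Proof.
move=> T0 H; rewrite /time_change ge_max lee_fin T0/=.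
by apply: ge_ereal_sup => _ [t [Pt ts] <-]; rewrite lee_fin H.
Qed.

Lemma time_change_lt t s : P t -> s < sg t -> 0 <= s -> (tc s < t%:E)%E.
Proof.
move=> Pt st s0; have [c Pc cs] := clock_ivt D Pt s0 (ltW st).
have ct : c < t.
  by rewrite ltNge -(clock_le_mono D Pt Pc) cs -ltNge.
apply: (@le_lt_trans _ _ c%:E); last by rewrite lte_fin.
apply: time_change_ub => [|a Pa]; first exact: (period_ge0 D Pc).
by rewrite -cs (clock_le_mono D Pa Pc).
Qed.

Lemma time_change_clock t : P t -> tc (sg t) = t%:E.
Proof.
move=> Pt; apply/eqP; rewrite eq_le time_change_lb// andbT.
apply: time_change_ub => [|a Pa]; first exact: (period_ge0 D Pt).
by rewrite (clock_le_mono D Pa Pt).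
Qed.

Lemma time_change_over s : (forall t, P t -> sg t <= s) -> tc s = end_time P.
Proof.
move=> H; apply/eqP; rewrite eq_le time_change_le_end/=.
rewrite /end_time ge_max time_change_ge0/=.
by apply: ge_ereal_sup => _ [t Pt <-]; exact: time_change_lb (H _ Pt).
Qed.

Lemma clock_cases s : 0 <= s ->
  (exists2 t, P t & sg t = s) \/ (forall t, P t -> sg t <= s).
Proof.
move=> s0; have [[b Pb sb]|H] := pselect (exists2 b, P b & s < sg b).
  by left; have [t Pt ts] := clock_ivt D Pb s0 (ltW sb); exists t.
right => t Pt; rewrite leNgt; apply/negP => st.
by apply: H; exists t.
Qed.

Lemma time_change_gt_near c s : (c%:E < tc s)%E ->
  \forall x \near s, (c%:E < tc x)%E.
Proof.
move=> cs; have [c0|c0] := ltP c 0.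
  by near=> x; rewrite (lt_le_trans _ (time_change_ge0 x)) ?lte_fin.
move: cs; rewrite {1}/time_change lt_max => /orP[|].
  by rewrite lte_fin ltNge c0.
move=> /ereal_sup_gt[_ [t [Pt ts] <-]]; rewrite lte_fin => ct.
pose d := (c + t) / 2.
have cd : c < d by rewrite /d; lra.
have dt : d < t by rewrite /d; lra.
have d0 : 0 <= d by rewrite (le_trans c0)// ltW.
have Pd : P d by apply: (period_down D Pt d0); exact: ltW.
have ds : sg d < s by apply: lt_le_trans ts; exact: (clock_lt D Pt d0 dt).
near=> x; apply: (@lt_le_trans _ _ d%:E); first by rewrite lte_fin.
apply: time_change_lb => //; apply: ltW; near: x; exact: lt_nbhsr.
Unshelve. all: end_near. Qed.

Lemma time_change_le_near c s : (tc s < c%:E)%E ->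
  \forall x \near s, 0 <= x -> (tc x <= c%:E)%E.
Proof.
move=> sc; have c0 : 0 <= c.
  by rewrite -lee_fin (le_trans (time_change_ge0 s))// ltW.
have [Pc|nPc] := pselect (P c).
  have scl : s < sg c.
    by rewrite ltNge; apply/negP => /(time_change_lb Pc); rewrite leNgt sc.
  near=> x => x0; apply/ltW/time_change_lt => //.
  by near: x; exact: lt_nbhsl.
near=> x => x0; apply: time_change_ub => // t Pt _.
by rewrite leNgt; apply/negP => ct; apply: nPc; apply: (period_down D Pt c0 (ltW ct)).
Unshelve. all: end_near. Qed.

(** A monotone map whose sublevel and superlevel sets are described by the
   strictly increasing clock has no jumps. *)
Lemma time_change_continuous : {within `[0, +oo[, continuous tc}.
Proof.
apply/subspace_continuousP => s; rewrite /= in_itv/= andbT => s0.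
have gtW c : (c%:E < tc s)%E -> \forall x \near within `[0, +oo[%classic (nbhs s), (c%:E < tc x)%E.
  by move=> /time_change_gt_near H; rewrite near_withinE; apply: filterS H.
have leW c : (tc s < c%:E)%E -> \forall x \near within `[0, +oo[%classic (nbhs s), (tc x <= c%:E)%E.
  move=> /time_change_le_near H; rewrite near_withinE; apply: filterS H => x H.
  by rewrite /= in_itv/= andbT => /H.
suff : tc x @[x --> within `[0, +oo[%classic (nbhs s)] --> tc s by [].
case sE : (tc s) => [r| |]; last by have := time_change_ge0 s; rewrite sE.
  apply/fine_cvgP; split.
    have := leW (r + 1); rewrite sE lte_fin ltrDl ltr01 => /(_ isT).
    apply: filterS => x xr; rewrite ge0_fin_numE ?time_change_ge0//.
    by rewrite (le_lt_trans xr)// ltry.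
  apply/cvgrPdist_le => e e0.
  have := gtW (r - e); rewrite sE lte_fin ltrBlDr ltrDl e0 => /(_ isT).
  have := leW (r + e); rewrite sE lte_fin ltrDl e0 => /(_ isT).
  apply: filterS2 => x /=; have := time_change_ge0 x.
  case: (tc x) => //= y _; rewrite !lee_fin lte_fin => ye ey.
  rewrite ler_norml; apply/andP; split; lra.
by apply/cvgeyPgt => A; apply: gtW; rewrite sE ltry.
Qed.

End time_change.

(** * Length, and the end of the active period *)

Section endpoint.
Context {R : realType} {S : completeMetricType R}.
Notation mu := (@lebesgue_measure R).
Variable f : S -> \bar R.
Hypothesis f_gtNy : forall v, (-oo < f v)%E.
Hypothesis f_lsc : lower_semicontinuous f.
Variable p0 : R.
Hypothesis f_convex : plambda_convex p0 0 f.
Variables (p p' : R) (u0 : S) (u : R -> S).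
Hypotheses (p1 : 1 < p) (p'1 : 1 < p') (u0f : effective_domain f u0).
Hypothesis uC : CMS f p +oo%E u0 u.

Local Notation q := (conj_exponent p).
Local Notation q' := (conj_exponent p').
Local Notation al := (conj_exponent p - conj_exponent p').
Local Notation P := (active f u).
Local Notation h := (slope_along f u).
Local Notation sg := (clock h al).

#[local] Opaque local_slope clock active.

Lemma flow_clockable : clockable P h al.
Proof.
apply: (active_clockable f_gtNy f_convex p1 u0f uC).
by rewrite gerBl ltW// (lt_trans ltr01)// (conj_exponentE p'1).1.
Qed.
Let D := flow_clockable.

Let q'10 : 0 < q' - 1. Proof. by rewrite subr_gt0 (conj_exponentE p'1).1. Qed.

(** The old speed [h^(q-1)] is the rate [h^(q-q')] of the new clock times the new
   speed [h^(q'-1)], and the latter is largest at time [a]. *)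
Lemma length_le_clock a b : P b -> 0 < a -> a <= b ->
  mdist (u a) (u b) <= h a `^ (q' - 1) * (sg b - sg a).
Proof.
move=> Pb a0 ab.
have ai : mu.-integrable `[a, b] (EFin \o (fun r => h r `^ al)).
  by apply: integrable_subitv (rate_int D Pb) => //; exact: ltW.
have Wi : mu.-integrable `[a, b] (EFin \o (fun r => h a `^ (q' - 1) * h r `^ al)).
  have := @integrableZl _ _ _ mu _ (measurable_itv `[a, b]) (h a `^ (q' - 1)) _ ai.
  by apply: eq_integrable => // r _; rewrite /= EFinM.
have := CMS_length_le f_gtNy f_convex p1 u0f uC (ltW a0) ab Wi.
rewrite RintegralZl// => H.
have -> : sg b - sg a = \int[mu]_(r in `[a, b]) (h r `^ al).
  by rewrite (clockB D Pb (ltW a0) ab) addrAC subrr add0r.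
apply: H => r /andP[ar rb].
have r0 : 0 < r := lt_trans a0 ar.
have hr : 0 < h r.
  exact: (rate_gt0 D (period_down D Pb (ltW r0) (ltW rb)) r0).
have -> : fine (local_slope f (u r)) `^ (q - 1) = h r `^ (q' - 1) * h r `^ al.
  rewrite -powRD; first by congr (_ `^ _); ring.
  by rewrite (gt_eqF hr) implybT.
apply: ler_wpM2r; first exact: powR_ge0.
apply: ge0_ler_powR; rewrite ?nnegrE; first exact: ltW.
- exact: ltW.
- by apply/ltW/(lt_le_trans hr); exact: (rate_ni D a0 (ltW ar)).
- exact: (rate_ni D a0 (ltW ar)).
Qed.

#[local] Opaque slope_along.

Lemma active_cases :
  (end_time P = +oo%E /\ forall t, 0 <= t -> P t) \/
  (exists T, [/\ 0 <= T, end_time P = T%:E, forall t, 0 <= t -> P t <-> t < T,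
     local_slope f (u T) = 0%E & forall t, T <= t -> u t = u T]).
Proof.
case TE : (end_time P) => [T| |].
- right; have T0 : 0 <= T by rewrite -lee_fin -TE /end_time le_max lexx.
  have PT t : 0 <= t -> P t <-> t < T.
    by move=> t0; rewrite (active_lt_end D t0) TE lte_fin.
  have nPT : ~ P T by move/(PT _ T0); rewrite ltxx.
  exists T; split; [exact: T0|by []|exact: PT|exact: inactive_slope|].
  by move=> t Tt; exact: (inactive_stationary f_gtNy f_convex p1 u0f uC T0 Tt nPT).
- left; split=> // t t0; apply/(active_lt_end D t0).
  by rewrite TE ltry.
- have : (0 <= end_time P)%E by rewrite le_max lexx.
  by rewrite TE.
Qed.

Section finite_clock.
Variable s : R.
Hypothesis sgs : forall t, P t -> sg t <= s.

(** A bounded clock makes the curve Cauchy, as distances are bounded by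
   increments of the clock. *)
Lemma finite_clock_cvg : (forall t, 0 <= t -> P t) -> cvg (u r @[r --> +oo]).
Proof.
move=> Pall; apply: cauchy_cvg; apply: cauchy_exP => e e0.
pose K := h 1 `^ (q' - 1) + 1.
have K0 : 0 < K by rewrite ltr_wpDl// powR_ge0.
pose A := [set sg t | t in P].
have supA : has_sup A.
  split; first by exists (sg 0), 0 => //; exact: Pall.
  by exists s => _ [t Pt <-]; exact: sgs.
have eK : 0 < e / K by rewrite divr_gt0.
have [_ [t0 Pt0 <-] t0e] := sup_adherent eK supA.
pose t1 := Num.max t0 1.
have t11 : 1 <= t1 by rewrite le_max lexx orbT.
have t10 : 0 < t1 := lt_le_trans ltr01 t11.
have P1 : P t1 by apply: Pall; exact: ltW.
have sgt1 : sup A - e / K < sg t1.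
  apply: lt_le_trans t0e _; apply: (clock_le D P1 (period_ge0 D Pt0)).
  by rewrite le_max lexx.
exists (u t1); apply: (filterS _ (nbhs_pinfty_gt (num_real t1))) => r t1r.
have Pr : P r by apply: Pall; rewrite ltW// (lt_trans t10).
rewrite /= ballEmdist /=.
apply: le_lt_trans (length_le_clock Pr t10 (ltW t1r)) _.
have sgr : sg r - sg t1 < e / K.
  rewrite ltrBlDr -ltrBlDl; apply: le_lt_trans sgt1.
  by rewrite lerB// ub_le_sup//; [case: supA|exists r].
apply: (@le_lt_trans _ _ (K * (sg r - sg t1))).
  apply: ler_wpM2r.
    by rewrite subr_ge0 (clock_le D Pr (ltW t10) (ltW t1r)).
  rewrite /K -[leLHS]addr0; apply: lerD; last exact: ler01.
  apply: ge0_ler_powR; rewrite ?nnegrE; first exact: ltW.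
  - by apply/ltW; exact: (rate_gt0 D P1 t10).
  - by apply/ltW; exact: (rate_gt0 D (Pall _ ler01) ltr01).
  - exact: (rate_ni D ltr01 t11).
by rewrite mulrC -ltr_pdivlMr.
Qed.

Local Notation e := (curve_at u (end_time P)).

Lemma endpoint_cases :
  ((forall t, 0 <= t -> P t) /\ u r @[r --> +oo] --> e) \/
  (exists T, [/\ 0 <= T, e = u T, forall t, 0 <= t -> P t <-> t < T,
     local_slope f (u T) = 0%E & forall t, T <= t -> u t = u T]).
Proof.
have [[TE Pall]|[T [T0 TE PT sT uT]]] := active_cases; last first.
  by right; exists T; rewrite TE.
by left; split=> //; rewrite TE; exact: finite_clock_cvg.
Qed.

(** Common to an active period that ends and one that does not: the endpoint is a
   limit of active positions. *)
Lemma endpoint_approach t d : P t -> 0 < d ->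
  exists t2, [/\ t < t2, P t2 & mdist (u t2) e < d].
Proof.
move=> Pt d0; have t0 := period_ge0 D Pt.
have [[Pall cv]|[T [T0 eT PT _ _]]] := endpoint_cases.
  have H : \forall r \near +oo, mdist e (u r) < d.
    exact: (metricType_numDomainType.cvgr_dist_lt cv).
  near (pinfty_nbhs R) => r.
  have tr : t < r by near: r; apply: nbhs_pinfty_gt; exact: num_real.
  exists r; split; [exact: tr| |by rewrite metric_sym; near: r].
  by apply: Pall; exact: le_trans t0 (ltW tr).
have [d1 d10 d1P] := CMS_continuous uC T0 d0.
have tT : t < T by apply/(PT _ t0).
pose t2 := Num.max ((t + T) / 2) (T - d1 / 2).
have tt2 : t < t2 by rewrite lt_max; apply/orP; left; lra.
have t2T : t2 < T by rewrite gt_max; apply/andP; split; lra.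
have t20 : 0 <= t2 by rewrite ltW// (le_lt_trans t0).
exists t2; split; [exact: tt2|exact/PT|].
rewrite eT metric_sym; apply: d1P => //.
rewrite ltr0_norm ?subr_lt0// opprB ltrBlDr -ltrBlDl lt_max.
by apply/orP; right; lra.
Unshelve. all: end_near. Qed.

Lemma endpoint_dist t : P t -> 0 < t ->
  mdist (u t) e <= h t `^ (q' - 1) * (s - sg t).
Proof.
move=> Pt t0; apply/ler_addgt0Pr => d d0.
have [t2 [tt2 Pt2 t2d]] := endpoint_approach Pt d0.
apply: le_trans (metric_triangle (u t) (u t2) e) _.
apply: lerD; last exact: ltW.
apply: le_trans (length_le_clock Pt2 t0 (ltW tt2)) _.
by apply: ler_wpM2l; [exact: powR_ge0|rewrite lerD2r sgs].
Qed.

Lemma endpoint_energy t : 0 <= t -> (f e <= f (u t))%E.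
Proof.
move=> t0; have [Pt|nPt] := pselect (P t); last first.
  have [[Pall _]|[T [T0 eT PT _ uT]]] := endpoint_cases.
    by exfalso; apply: nPt; exact: Pall.
  have Tt : T <= t by rewrite leNgt; apply/negP => /(PT _ t0).
  by rewrite eT uT// lexx.
rewrite leNgt -(energyK f_gtNy u0f uC t0); apply/negP => /f_lsc[V Ve VP].
move: Ve => /metricType_numDomainType.nbhs_mdistP[d /= d0 dV].
have [t2 [tt2 Pt2 t2d]] := endpoint_approach Pt d0.
have := VP (u t2) (dV _ _); rewrite /= metric_sym => /(_ t2d).
rewrite -(energyK f_gtNy u0f uC (period_ge0 D Pt2)) lte_fin ltNge.
by rewrite (CMS_energy_ni f_gtNy u0f uC t0 (ltW tt2)).
Qed.

(** If the period never ends, a slope bounded from below would make the clock grow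
   linearly; hence the slope tends to [0] and the bound
   [f (u t) - f w <= h t * d (u t) w] passes to the limit for every [w]. *)
Lemma endpoint_slope : local_slope f e = 0%E.
Proof.
have [[Pall cv]|[T [T0 eT _ uT _]]] := endpoint_cases; last by rewrite eT.
apply/eqP; rewrite eq_le local_slope_ge0 andbT.
have slow d : 0 < d -> exists t, [/\ 1 <= t, P t & h t < d].
  move=> d0; apply: contrapT => H.
  have hd t : 1 <= t -> d <= h t.
    move=> t1; rewrite leNgt; apply/negP => htd; apply: H; exists t; split => //.
    by apply: Pall; exact: le_trans t1.
  pose m := Num.min (d `^ al) (h 1 `^ al).
  have h10 : 0 < h 1 by rewrite (lt_le_trans d0)// hd.
  have m0 : 0 < m.
    by have := powR_gt0 al d0; have := powR_gt0 al h10; rewrite /m lt_min => -> ->.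
  have s0 : 0 <= s by rewrite -(clock0 h al) sgs//; exact: Pall.
  have [t tE] : exists t, t = 1 + (s + 1) / m by exists (1 + (s + 1) / m).
  have t1 : 1 <= t by rewrite tE lerDl divr_ge0 ?addr_ge0// ltW.
  have Pt : P t by apply: Pall; exact: le_trans t1.
  have : m * (t - 1) <= sg t - sg 1.
    rewrite (clockB D Pt ler01 t1) addrAC subrr add0r.
    apply: Rintegral_ge_cst => //.
      by apply: integrable_subitv (rate_int D Pt).
    move=> x /andP[x1 xt].
    by have /andP[] := powR_between al d0 (hd _ x1) (rate_ni D ltr01 x1).
  rewrite tE addrAC subrr add0r mulrC divfK ?gt_eqF// => sm.
  have := sgs Pt; have : sg 0 <= sg 1 by exact: (clock_le D (Pall _ ler01) (lexx 0) ler01).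
  by rewrite clock0 tE; move: sm; lra.
have ef : (f e < +oo)%E.
  by rewrite (le_lt_trans (endpoint_energy (lexx 0)))// (CMS_dom u0f uC).
apply: local_slope_le => // w fw; rewrite mul0r.
pose M := h 1 `^ (q' - 1) * s + mdist e w.
have s0 : 0 <= s by rewrite -(clock0 h al) sgs//; exact: Pall.
have M0 : 0 <= M by rewrite addr_ge0 ?mulr_ge0 ?powR_ge0 ?mdist_ge0.
apply/ler_addgt0Pl => d d0; rewrite addr0.
have dM : 0 < d / (M + 1) by rewrite divr_gt0// ltr_wpDl.
have [t [t1 Pt htd]] := slow _ dM.
have t0 : 0 < t := lt_le_trans ltr01 t1.
have H1 : energy f u t - fine (f w) <= h t * mdist (u t) w.
  apply: (local_slope_ge f_gtNy f_convex) => //; first exact: (CMS_dom u0f uC (ltW t0)).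
  by rewrite (slope_alongK f_gtNy f_convex p1 u0f uC t0).
have H2 : mdist (u t) w <= M.
  apply: le_trans (metric_triangle (u t) e w) _; rewrite lerD2r.
  apply: le_trans (endpoint_dist Pt t0) _; apply: ler_pM.
  - exact: powR_ge0.
  - by rewrite subr_ge0 sgs.
  - apply: ge0_ler_powR; rewrite ?nnegrE; first exact: ltW.
    + by apply/ltW; exact: (rate_gt0 D Pt t0).
    + by apply/ltW; exact: (rate_gt0 D (Pall _ ler01) ltr01).
    + exact: (rate_ni D ltr01 t1).
  - rewrite lerBlDr lerDl -(clock0 h al).
    exact: (clock_le D Pt (lexx 0) (ltW t0)).
have H3 : fine (f e) <= energy f u t.
  rewrite -lee_fin (energyK f_gtNy u0f uC (ltW t0)) fineK ?fin_numElt ?f_gtNy//.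
  exact: endpoint_energy (ltW t0).
have H4 : h t * mdist (u t) w <= d.
  apply: (@le_trans _ _ (d / (M + 1) * (M + 1))); last by rewrite divfK// gt_eqF// ltr_wpDl.
  apply: ler_pM; [|exact: mdist_ge0|exact: ltW|by rewrite (le_trans H2)// lerDl].
  by apply/ltW; exact: (rate_gt0 D Pt t0).
by lra.
Qed.

End finite_clock.

(** An infinite value is taken only once the clock has run out. *)
Lemma time_change_attained s : 0 <= s -> time_change P h al s = +oo%E ->
  cvg (u r @[r --> +oo]).
Proof.
move=> s0; have [[t Pt <-]|over] := clock_cases D s0.
  by rewrite (time_change_clock D Pt).
rewrite (time_change_over over) => TE.
have [[_ Pall]|[T [_]]] := active_cases; last by rewrite TE.
exact: (finite_clock_cvg over Pall).
Qed.

End endpoint.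

(** * Transport of null sets and derivatives by the clock *)

Section clock_inverse.
Context {R : realType}.
Notation mu := (@lebesgue_measure R).
Variables (P : set R) (h : R -> R) (al : R).
Hypothesis D : clockable P h al.

Local Notation sg := (clock h al).

(** The clock is Lipschitz on each of countably many intervals, with rational
   ends, that exhaust the active period after time [0]. *)
Lemma clock_negligible (N : set R) : mu.-negligible N ->
  mu.-negligible (sg @` (N `&` [set t | P t /\ 0 < t])).
Proof.
move=> N0.
pose F n : set R := if @unpickle (rat * rat)%type n is Some ab then
  [set s | (0 < (ratr ab.1 : R) /\ P (ratr ab.2)) /\
           (sg @` (N `&` `[ratr ab.1, ratr ab.2])) s] else set0.
have F0 n : mu.-negligible (F n).
  rewrite /F; case: unpickle => [[a b]|]; last exact: negligible_set0.
  have [[a0 Pb]|nab] := pselect (0 < (ratr a : R) /\ P (ratr b)); last first.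
    by apply: negligibleS (negligible_set0 _) => s [] /nab.
  have [ab|ba] := leP (ratr a : R) (ratr b); last first.
    apply: negligibleS (negligible_set0 _) => s [_ [t [_ +] _]].
    by rewrite /= in_itv/= => /andP[at' tb]; have := lt_le_trans ba (le_trans at' tb); rewrite ltxx.
  have [c [C [c0 C0 cC]]] := clock_rate D Pb a0 ab.
  apply: negligibleS (_ : mu.-negligible (sg @` (N `&` `[ratr a, ratr b]))).
    by move=> s [].
  apply: (negligible_image_lipschitz C0 _ N0) => x y ax xy yb.
  have /andP[H ->] := cC x y ax xy yb.
  by rewrite andbT (le_trans _ H)// mulr_ge0 ?subr_ge0// ltW.
apply: negligibleS (negligible_bigcup F0) => _ [t [Nt [Pt t0]] <-].
have [a] := rat_in_itvoo t0; rewrite in_itv/= => /andP[a0 at'].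
have [t' tt' Pt'] := period_open D Pt.
have [b] := rat_in_itvoo tt'; rewrite in_itv/= => /andP[tb bt'].
exists (pickle (a, b)); first exact: I.
rewrite /F pickleK; split => /=.
  split => //; apply: (period_down D Pt' _ (ltW bt')).
  by rewrite ltW// (lt_trans t0).
by exists t => //; split => //; rewrite /= in_itv/= !ltW.
Qed.

(** A quantitative inverse: a new time [s] near [sg t0] comes from an old time [y]
   near [t0], at a comparable distance. *)
Lemma clock_inverse_near t0 : P t0 -> 0 < t0 -> exists2 k, 0 < k &
  forall Q : R -> Prop, (\forall y \near t0, Q y) ->
  \forall s \near sg t0, exists y,
    [/\ P y, sg y = s, `|y - t0| <= k * `|s - sg t0| & Q y].
Proof.
move=> Pt0 t00; have [b tb Pb] := period_open D Pt0.
pose a := t0 / 2.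
have a0 : 0 < a by rewrite divr_gt0.
have at0 : a < t0 by rewrite ltr_pdivrMr// ltr_pMr// ltr1n.
have ab : a < b := lt_trans at0 tb.
have [c [C [c0 C0 cC]]] := clock_rate D Pb a0 (ltW ab).
have ci0 : 0 < c^-1 by rewrite invr_gt0.
have lip x y : a <= x <= b -> a <= y <= b -> `|y - x| <= c^-1 * `|sg y - sg x|.
  move=> /andP[ax xb] /andP[ay yb]; rewrite mulrC ler_pdivlMr//.
  wlog xy : x y ax xb ay yb / x <= y.
    by move=> H; have [/H|/ltW/H] := leP x y; [exact|rewrite distrC (distrC (sg y)); exact].
  have /andP[H _] := cC x y ax xy yb.
  rewrite ger0_norm ?subr_ge0// (le_trans _ (ler_norm _))// mulrC//.
exists c^-1 => // Q /nbhs_ballP[d /= d0 dQ].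
have Pa : P a by apply: (period_down D Pb (ltW a0)); exact: ltW.
near=> s.
have sa : sg a < s by near: s; apply: lt_nbhsr; exact: (clock_lt D Pt0 (ltW a0) at0).
have sb : s < sg b by near: s; apply: lt_nbhsl; exact: (clock_lt D Pb (ltW t00) tb).
have s0 : 0 <= s.
  by rewrite -(clock0 h al) ltW// (le_lt_trans _ sa)// (clock_le D Pa)// ltW.
have [y Py ys] := clock_ivt D Pb s0 (ltW sb).
have ay : a < y by rewrite ltNge -(clock_le_mono D Py Pa) ys -ltNge.
have yb : y < b by rewrite ltNge -(clock_le_mono D Pb Py) ys -ltNge.
have yt : `|y - t0| <= c^-1 * `|s - sg t0|.
  by rewrite -ys lip// !ltW.
exists y; split => //; apply: dQ; rewrite /ball/= distrC (le_lt_trans yt)//.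
rewrite mulrC ltr_pdivrMr//; near: s.
apply/nbhs_ballP; exists (d * c) => /=; first by rewrite mulr_gt0.
by move=> s; rewrite /ball/= distrC.
Unshelve. all: end_near. Qed.

(** The chain rule for the inverse of the clock, without dividing by the rate
   [w]. *)
Lemma deriv_at_clock (F G : R -> R) t0 l w : P t0 -> 0 < t0 ->
  deriv_at sg t0 w -> deriv_at F t0 (l * w) ->
  (forall y, P y -> G (sg y) = F y) -> deriv_at G (sg t0) l.
Proof.
move=> Pt0 t00 dsg dF GF e e0.
have [k k0 kP] := clock_inverse_near Pt0 t00.
pose e1 := e / (k * (1 + `|l|)).
have l1 : 0 < 1 + `|l| by rewrite ltr_pwDl.
have e10 : 0 < e1 by rewrite divr_gt0// mulr_gt0.
have near_t : \forall y \near t0, `|sg y - sg t0 - w * (y - t0)| <= e1 * `|y - t0| /\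
    `|F y - F t0 - l * w * (y - t0)| <= e1 * `|y - t0|.
  by near=> y; split; near: y; [exact: dsg|exact: dF].
have near_s := kP _ near_t.
apply: filter_app near_s; near=> s; case=> y [Py <- yt [H1 H2]].
rewrite !GF//.
have -> : F y - F t0 - l * (sg y - sg t0) = (F y - F t0 - l * w * (y - t0)) -
    l * (sg y - sg t0 - w * (y - t0)) by ring.
apply: le_trans (ler_normB _ _) _; rewrite normrM.
have H3 : `|l| * `|sg y - sg t0 - w * (y - t0)| <= `|l| * (e1 * `|y - t0|).
  exact: ler_wpM2l.
have H4 : e1 * (1 + `|l|) * `|y - t0| <= e1 * (1 + `|l|) * (k * `|sg y - sg t0|).
  by rewrite ler_pM2l// mulr_gt0.
have <- : e1 * (1 + `|l|) * (k * `|sg y - sg t0|) = e * `|sg y - sg t0|.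
  by rewrite /e1; field; rewrite !gt_eqF.
apply: le_trans H4.
have -> : e1 * (1 + `|l|) * `|y - t0| = e1 * `|y - t0| + `|l| * (e1 * `|y - t0|) by ring.
exact: lerD.
Unshelve. all: end_near. Qed.

Lemma mderiv_at_clock (S : metricType R) (u U : R -> S) t0 l w :
  P t0 -> 0 < t0 -> 0 <= w ->
  deriv_at sg t0 w -> mderiv_at u t0 (l * w) ->
  (forall y, P y -> U (sg y) = u y) -> mderiv_at U (sg t0) l.
Proof.
move=> Pt0 t00 w0 dsg du Uu e e0.
have [k k0 kP] := clock_inverse_near Pt0 t00.
pose e1 := e / (k * (1 + `|l|)).
have l1 : 0 < 1 + `|l| by rewrite ltr_pwDl.
have e10 : 0 < e1 by rewrite divr_gt0// mulr_gt0.
have near_t : \forall y \near t0, `|sg y - sg t0 - w * (y - t0)| <= e1 * `|y - t0| /\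
    `|mdist (u t0) (u y) - l * w * `|y - t0| | <= e1 * `|y - t0|.
  by near=> y; split; near: y; [exact: dsg|exact: du].
have near_s := kP _ near_t.
apply: filter_app near_s; near=> s; case=> y [Py <- yt [H1 H2]].
rewrite !Uu//.
have -> : mdist (u t0) (u y) - l * `|sg y - sg t0| =
    (mdist (u t0) (u y) - l * w * `|y - t0|) -
    l * (`|sg y - sg t0| - w * `|y - t0|) by ring.
apply: le_trans (ler_normB _ _) _; rewrite normrM.
have H5 : `| `|sg y - sg t0| - w * `|y - t0| | <= e1 * `|y - t0|.
  apply: le_trans H1; rewrite -{1}(ger0_norm w0) -normrM.
  exact: ler_dist_dist.
have H3 : `|l| * `| `|sg y - sg t0| - w * `|y - t0| | <= `|l| * (e1 * `|y - t0|).
  exact: ler_wpM2l.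
have H4 : e1 * (1 + `|l|) * `|y - t0| <= e1 * (1 + `|l|) * (k * `|sg y - sg t0|).
  by rewrite ler_pM2l// mulr_gt0.
have <- : e1 * (1 + `|l|) * (k * `|sg y - sg t0|) = e * `|sg y - sg t0|.
  by rewrite /e1; field; rewrite !gt_eqF.
apply: le_trans H4.
have -> : e1 * (1 + `|l|) * `|y - t0| = e1 * `|y - t0| + `|l| * (e1 * `|y - t0|) by ring.
exact: lerD.
Unshelve. all: end_near. Qed.

End clock_inverse.

Section length_of_slowing_curves.
Context {R : realType} {S : metricType R}.
Notation mu := (@lebesgue_measure R).

(** Where [m] is the derivative of its integral, the bound [m x * (y - x)] agrees
   with the integral bound to first order in [y - x]. *)
Lemma slowing_length_le (U : R -> S) (m : R -> R) a b : a <= b ->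
  mu.-integrable `[a, b] (EFin \o m) ->
  (forall x, 0 <= m x) ->
  (forall x y, a <= x -> x <= y -> y <= b -> m y <= m x) ->
  (forall x y, a <= x -> x <= y -> y <= b ->
    mdist (U x) (U y) <= m x * (y - x)) ->
  mdist (U a) (U b) <= \int[mu]_(r in `[a, b]) m r.
Proof.
move=> ab mi m0 mni Um.
suff : mdist (U a) (U b) - \int[mu]_(r in `[a, b]) m r <=
       mdist (U a) (U a) - \int[mu]_(r in `[a, a]) m r.
  by rewrite mdistxx set_itv1 Rintegral_set1 subrr subr_le0.
apply: (@nonincreasing_of_dini R
  (fun x => mdist (U a) (U x) - \int[mu]_(r in `[a, x]) m r) (cst (m a))) => //.
- by apply: (@integrable_bounded_itv _ _ _ _ (m a)) => //= x _; rewrite m0 lexx.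
- by move=> r; exact: m0.
- move=> x y ax xy yb; rewrite (Rintegral_itv_cst _ xy).
  have may : mu.-integrable `[a, y] (EFin \o m) by exact: integrable_subitv mi.
  rewrite (Rintegral_chasles ax xy may).
  have : 0 <= \int[mu]_(r in `[x, y]) m r by exact: Rintegral_ge0.
  have := mdist_sub_le (U a) (U x) (U y).
  have := Um _ _ ax xy yb.
  have : m x * (y - x) <= m a * (y - x).
    by rewrite ler_wpM2r ?subr_ge0// mni// (le_trans xy).
  lra.
apply: ae_imply (ae_deriv_integral ab mi) => x dm axb e e0.
have {}dm := dm axb; move: axb => /andP[ax xb].
near=> y.
have xy : x < y by near: y; exact: nbhs_right_gt.
have yb : y <= b by near: y; exact: nbhs_right_le.
have yx0 : 0 < y - x by rewrite subr_gt0.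
have H1 : `|\int[mu]_(r in `[a, y]) m r - \int[mu]_(r in `[a, x]) m r
   - m x * (y - x)| <= e * `|y - x|.
  by near: y; apply: near_right_of_near; exact: dm.
rewrite (gtr0_norm yx0) in H1.
move: H1; rewrite ler_norml => /andP[H1 _].
have := mdist_sub_le (U a) (U x) (U y).
have := Um _ _ (ltW ax) (ltW xy) yb.
lra.
Unshelve. all: end_near. Qed.

(** The equality case of Young's inequality read backwards. *)
Lemma max_slope_ineqI (f : S -> \bar R) p (U : R -> S) s : 1 < p ->
  (local_slope f (U s) < +oo)%E ->
  deriv_at (energy f U) s (- slope_along f U s `^ conj_exponent p) ->
  mderiv_at U s (slope_along f U s `^ (conj_exponent p - 1)) ->
  max_slope_ineq f p U s.
Proof.
move=> p1 sfin dE dU.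
have [dE1 dE2] := derivable_deriv_at dE.
have cU := (mderiv_atP U s _).2 dU.
split; [exact: dE1|by apply/cvg_ex; eexists; exact: cU|].
have -> : metric_derivative U s = slope_along f U s `^ (conj_exponent p - 1).
  by apply/cvg_lim.
rewrite dE2.
have -> : local_slope f (U s) = (slope_along f U s)%:E.
  by rewrite /slope_along fineK// ge0_fin_numE// local_slope_ge0.
have [q1 pq] := conj_exponentE p1.
have p0 : p != 0 by rewrite gt_eqF// (lt_trans ltr01).
have q0 : conj_exponent p != 0 by rewrite gt_eqF// (lt_trans ltr01).
rewrite poweR_EFin -EFinM -EFinN -EFinB lee_fin.
rewrite -powRrM (conj_exponent_mul p0 q0 pq).
set z := slope_along f U s `^ _.
have : (p^-1 + (conj_exponent p)^-1) * z = z by rewrite pq mul1r.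
lra.
Qed.

End length_of_slowing_curves.

(** * The reparametrised curve *)

Section reparametrized.
Context {R : realType} {S : completeMetricType R}.
Notation mu := (@lebesgue_measure R).
Variable f : S -> \bar R.
Hypothesis f_gtNy : forall v, (-oo < f v)%E.
Hypothesis f_lsc : lower_semicontinuous f.
Variable p0 : R.
Hypothesis f_convex : plambda_convex p0 0 f.
Variables (p p' : R) (u0 : S) (u : R -> S).
Hypotheses (p1 : 1 < p) (p'1 : 1 < p') (u0f : effective_domain f u0).
Hypothesis uC : CMS f p +oo%E u0 u.

Local Notation q := (conj_exponent p).
Local Notation q' := (conj_exponent p').
Local Notation al := (conj_exponent p - conj_exponent p').
Local Notation P := (active f u).
Local Notation h := (slope_along f u).
Local Notation sg := (clock h al).
Local Notation e := (curve_at u (end_time P)).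

Definition reparam (s : R) : S := curve_at u (time_change P h al s).
Local Notation U := reparam.
Local Notation k := (slope_along f U).

#[local] Opaque local_slope clock active time_change end_time.

Let D := flow_clockable f_gtNy f_convex p1 p'1 u0f uC.
Let q'1 : 1 < q'. Proof. exact: (conj_exponentE p'1).1. Qed.
Let q'10 : 0 < q' - 1. Proof. by rewrite subr_gt0 (conj_exponentE p'1).1. Qed.

Lemma reparam_clock t : P t -> U (sg t) = u t.
Proof. by move=> Pt; rewrite /reparam (time_change_clock D Pt). Qed.

Lemma reparam_over s : (forall t, P t -> sg t <= s) -> U s = e.
Proof. by move=> H; rewrite /reparam (time_change_over H). Qed.

Lemma slope_reparam_clock t : P t -> k (sg t) = h t.
Proof. by move=> Pt; rewrite /slope_along reparam_clock. Qed.

Lemma slope_reparam_over s : (forall t, P t -> sg t <= s) -> k s = 0.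
Proof.
move=> H; rewrite /slope_along reparam_over//.
by rewrite (endpoint_slope f_gtNy f_lsc f_convex p1 p'1 u0f uC H).
Qed.

Lemma active_pos t : P t -> 0 < sg t -> 0 < t.
Proof.
move=> Pt st; rewrite lt_neqAle (period_ge0 D Pt) andbT.
by apply: contraTneq st => <-; rewrite clock0 ltxx.
Qed.

#[local] Opaque slope_along.

Lemma energy_reparam_ni s t : 0 <= s -> s <= t -> (f (U t) <= f (U s))%E.
Proof.
move=> s0 st.
have [[x Px xs]|sover] := clock_cases D s0; last first.
  have tover y : P y -> sg y <= t by move=> Py; exact: le_trans (sover _ Py) st.
  by rewrite (reparam_over sover) (reparam_over tover).
have x0 := period_ge0 D Px.
have [[y Py yt]|tover] := clock_cases D (le_trans s0 st).
  rewrite -xs -yt (reparam_clock Px) (reparam_clock Py).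
  have xy : x <= y by rewrite -(clock_le_mono D Px Py) xs yt.
  rewrite -(energyK f_gtNy u0f uC x0) -(energyK f_gtNy u0f uC (le_trans x0 xy)).
  by rewrite lee_fin (CMS_energy_ni f_gtNy u0f uC x0 xy).
rewrite (reparam_over tover) -xs (reparam_clock Px).
exact: (endpoint_energy f_gtNy f_lsc f_convex p1 p'1 u0f uC tover x0).
Qed.

Lemma reparam0 : U 0 = u0.
Proof.
have [_ <- _ _] := uC.
have [P0|nP0] := pselect (P 0).
  by have := reparam_clock P0; rewrite clock0.
have over0 t : P t -> sg t <= 0.
  move=> Pt; exfalso; apply: nP0.
  exact: (period_down D Pt (lexx 0) (period_ge0 D Pt)).
rewrite (reparam_over over0).
have [[Pall _]|[T [T0 -> PT _ _]]] :=
  endpoint_cases f_gtNy f_convex p1 p'1 u0f uC over0.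
  by exfalso; apply: nP0; exact: Pall.
move: T0; rewrite le_eqVlt => /predU1P[<-//|T0].
by exfalso; apply: nP0; apply/PT.
Qed.

Lemma reparam_dom s : 0 <= s -> (f (U s) < +oo)%E.
Proof.
move=> s0; apply: le_lt_trans (energy_reparam_ni (lexx 0) s0) _.
by rewrite reparam0; exact: u0f.
Qed.

Lemma reparam_energy_ni s t : 0 <= s -> s <= t -> energy f U t <= energy f U s.
Proof.
move=> s0 st; have t0 := le_trans s0 st.
have EK r : 0 <= r -> (energy f U r)%:E = f (U r).
  by move=> r0; rewrite /energy fineK// fin_numElt f_gtNy reparam_dom.
by rewrite -lee_fin !EK// energy_reparam_ni.
Qed.

Lemma slope_reparam_ge0 s : 0 <= k s.
Proof. exact: slope_along_ge0. Qed.

Lemma slope_reparam_ni s t : 0 < s -> s <= t -> k t <= k s.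
Proof.
move=> s0 st.
have [[y Py yt]|tover] := clock_cases D (le_trans (ltW s0) st); last first.
  by rewrite (slope_reparam_over tover) slope_reparam_ge0.
have [[x Px xs]|sover] := clock_cases D (ltW s0); last first.
  have tover z : P z -> sg z <= t by move=> Pz; exact: le_trans (sover _ Pz) st.
  by rewrite (slope_reparam_over tover) slope_reparam_ge0.
have x0 : 0 < x by apply: active_pos => //; rewrite xs.
rewrite -xs -yt (slope_reparam_clock Px) (slope_reparam_clock Py).
apply: (rate_ni D x0).
by rewrite -(clock_le_mono D Px Py) xs yt.
Qed.

Lemma reparam_dist_le s t : 0 < s -> s <= t ->
  mdist (U s) (U t) <= k s `^ (q' - 1) * (t - s).
Proof.
move=> s0 st; have t0 := le_trans (ltW s0) st.
have [[x Px xs]|sover] := clock_cases D (ltW s0); last first.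
  have tover z : P z -> sg z <= t by move=> Pz; exact: le_trans (sover _ Pz) st.
  rewrite (reparam_over sover) (reparam_over tover) mdistxx.
  by apply: mulr_ge0; [exact: powR_ge0|rewrite subr_ge0].
have x0 : 0 < x by apply: active_pos => //; rewrite xs.
have [[y Py yt]|tover] := clock_cases D t0.
  rewrite -xs -yt (slope_reparam_clock Px) (reparam_clock Px) (reparam_clock Py).
  apply: (length_le_clock f_gtNy f_convex p1 p'1 u0f uC Py x0).
  by rewrite -(clock_le_mono D Px Py) xs yt.
rewrite (reparam_over tover) -xs (slope_reparam_clock Px) (reparam_clock Px).
exact: (endpoint_dist f_gtNy f_convex p1 p'1 u0f uC tover Px x0).
Qed.

(** The pointwise equations that characterise the dissipation for the exponent
   [p']. *)
Definition regular_at s := [/\ (local_slope f (U s) < +oo)%E,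
  deriv_at (energy f U) s (- k s `^ q') & mderiv_at U s (k s `^ (q' - 1))].

Lemma reparam_regular_clock t : P t -> 0 < t ->
  deriv_at sg t (h t `^ al) -> deriv_at (energy f u) t (- h t `^ q) ->
  mderiv_at u t (h t `^ (q - 1)) -> regular_at (sg t).
Proof.
move=> Pt t0 dsg dE du.
have ht : 0 < h t := rate_gt0 D Pt t0.
have hq : h t `^ q = h t `^ q' * h t `^ al.
  rewrite -powRD; first by congr (_ `^ _); ring.
  by rewrite (gt_eqF ht) implybT.
have hq1 : h t `^ (q - 1) = h t `^ (q' - 1) * h t `^ al.
  rewrite -powRD; first by congr (_ `^ _); ring.
  by rewrite (gt_eqF ht) implybT.
rewrite /regular_at (slope_reparam_clock Pt); split.
- rewrite (reparam_clock Pt) -(slope_alongK f_gtNy f_convex p1 u0f uC t0).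
  exact: ltry.
- apply: (deriv_at_clock D Pt t0 dsg (F := energy f u)).
    by rewrite mulNr -hq; exact: dE.
  by move=> y Py; rewrite /energy (reparam_clock Py).
- apply: (mderiv_at_clock D Pt t0 (powR_ge0 _ _) dsg (u := u)).
    by rewrite -hq1; exact: du.
  by move=> y Py; exact: reparam_clock Py.
Qed.

(** Strictly after the clock has run out the curve rests at the endpoint. *)
Lemma reparam_regular_over s s' : s' < s ->
  (forall t, P t -> sg t <= s') -> regular_at s.
Proof.
move=> s's over.
have overx x : s' <= x -> forall t, P t -> sg t <= x.
  by move=> sx t Pt; exact: le_trans (over _ Pt) sx.
have Ue x : s' <= x -> U x = e by move=> sx; exact: (reparam_over (overx _ sx)).
have es := endpoint_slope f_gtNy f_lsc f_convex p1 p'1 u0f uC over.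
rewrite /regular_at (slope_reparam_over (overx _ (ltW s's))) powR0; last first.
  by rewrite gt_eqF// (lt_trans ltr01).
rewrite powR0 ?(gt_eqF q'10)// Ue ?(ltW s's)//; split.
- by rewrite es; exact: ltry.
- move=> d d0; near=> y; have sy : s' < y by near: y; exact: lt_nbhsr.
  rewrite /energy (Ue _ (ltW sy)) (Ue _ (ltW s's)) subrr oppr0 mul0r subr0 normr0.
  by rewrite mulr_ge0// ltW.
- move=> d d0; near=> y; have sy : s' < y by near: y; exact: lt_nbhsr.
  rewrite (Ue _ (ltW sy)) (Ue _ (ltW s's)) mdistxx mul0r subr0 normr0.
  by rewrite mulr_ge0// ltW.
Unshelve. all: end_near. Qed.

(** Exceptional new times are images of exceptional old times, with the possible
   exception of the single time [X] at which the clock runs out. *)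
Lemma reparam_regular_ae : {ae mu, forall s, 0 < s -> regular_at s}.
Proof.
have aet := ae_and (clock_deriv D) (CMS_ae f_gtNy f_convex p1 u0f uC).
have N0 := clock_negligible D aet.
pose X : set R := [set s | (forall t, P t -> sg t <= s) /\
   forall s', s' < s -> ~ (forall t, P t -> sg t <= s')].
have X0 : mu.-negligible X.
  have [[x [xover xmin]]|nX] := pselect (exists x, X x); last first.
    by apply: negligibleS (negligible_set0 _) => y Xy; apply: nX; exists y.
  have Xx : X `<=` [set x].
    move=> y [yover ymin]; have [xy|yx|->//] := ltgtP x y.
      by have := ymin _ xy xover.
    by have := xmin _ yx yover.
  have x0 : mu.-negligible [set x].
    by exists [set x]; split => //; exact: lebesgue_measure_set1.
  by apply: negligibleS x0.
apply: negligibleS (negligibleU N0 X0) => s /=.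
move=> /not_implyP[s0 nreg].
have [[t Pt ts]|sover] := clock_cases D (ltW s0).
  left; exists t => //; have t0 : 0 < t by apply: active_pos => //; rewrite ts.
  split; last by split.
  move=> [dsg /(_ t0)[_ dE du]]; apply: nreg; rewrite -ts.
  exact: (reparam_regular_clock Pt t0 (dsg t0 Pt) dE du).
right; split => // s' s's over'; apply: nreg.
exact: reparam_regular_over s's over'.
Qed.

(** Integrability of the speed near [0] follows from the dissipation of the new
   curve, exactly as for the clock. *)
Lemma reparam_rate_integrable K : 0 < K ->
  mu.-integrable `[0, K] (EFin \o (fun r => k r `^ (q' - 1))).
Proof.
move=> K0.
have kni a : 0 < a -> forall x y, 0 < x -> x <= y -> k y `^ a <= k x `^ a.
  move=> a0 x y x0 xy; apply: ge0_ler_powR; rewrite ?nnegrE; first exact: ltW.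
  - exact: slope_reparam_ge0.
  - exact: slope_reparam_ge0.
  - exact: slope_reparam_ni.
have q'0 : 0 < q' by rewrite (lt_trans ltr01).
have iq : mu.-integrable `[0, K] (EFin \o (fun r => k r `^ q')).
  apply: (@dissipation_integrable _ (energy f U) _ _ K0).
  - by move=> x; exact: powR_ge0.
  - exact: kni.
  - by move=> x y x0 xy; exact: reparam_energy_ni.
  - by apply: ae_imply reparam_regular_ae => x + x0 => /(_ x0)[].
have i1 : mu.-integrable `[0, K] (EFin \o cst (1 : R)).
  by apply: (@integrable_bounded_itv _ _ _ _ 1) => //= x _; rewrite lexx ler01.
have isum : mu.-integrable `[0, K] (EFin \o (fun r => 1 + k r `^ q')).
  have := @integrableD _ _ _ mu _ (measurable_itv _) _ _ i1 iq.
  by apply: eq_integrable => // x _.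
apply: le_integrable isum => //.
  apply/measurable_EFinP/measurable_fun_itv_obnd_cbndP.
  apply: measurable_funS (nonincreasing_on_measurable (kni _ q'10)) => //.
  exact: subset_itvl.
move=> r _; have k0 := slope_reparam_ge0 r.
have kq0 := powR_ge0 (k r) q'.
rewrite lee_fin !ger0_norm ?powR_ge0 ?addr_ge0//.
have [k1|k1] := leP 1 (k r).
  have : k r `^ (q' - 1) <= k r `^ q' by apply: ler_powR => //; rewrite gerBl ler01.
  lra.
have : k r `^ (q' - 1) <= 1 `^ (q' - 1).
  by apply: ge0_ler_powR; rewrite ?nnegrE; [exact: ltW|exact: k0|exact: ler01|exact: ltW].
rewrite powR1; lra.
Qed.

(** The distance bounds start at positive times because the slope may be infinite
   at time [0]; continuity of [u] closes this gap. *)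
Lemma reparam_near0 t d : 0 < t -> 0 < d ->
  exists2 x, 0 < x <= t & mdist (U 0) (U x) < d.
Proof.
move=> t0 d0; have [P0|nP0] := pselect (P 0); last first.
  have over x : forall y, P y -> sg y <= x.
    move=> y Py; exfalso; apply: nP0.
    exact: (period_down D Py (lexx 0) (period_ge0 D Py)).
  exists t; first by rewrite t0 lexx.
  by rewrite (reparam_over (over 0)) (reparam_over (over t)) mdistxx.
have [b b0 Pb] := period_open D P0.
have [d1 d10 d1P] := clock_small D Pb t0.
have [d2 d20 d2P] := CMS_continuous uC (lexx 0) d0.
pose y := Num.min b (Num.min (d1 / 2) (d2 / 2)).
have y0 : 0 < y by rewrite !lt_min b0 !divr_gt0.
have yb : y <= b by rewrite ge_min lexx.
have yd1 : y < d1.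
  apply: (@le_lt_trans _ _ (d1 / 2)); first by rewrite /y !ge_min lexx !orbT.
  by rewrite ltr_pdivrMr// ltr_pMr// ltr1n.
have yd2 : y < d2.
  apply: (@le_lt_trans _ _ (d2 / 2)); first by rewrite /y !ge_min lexx !orbT.
  by rewrite ltr_pdivrMr// ltr_pMr// ltr1n.
have Py : P y := period_down D Pb (ltW y0) yb.
exists (sg y).
  rewrite -{1}(clock0 h al) (clock_lt D Py (lexx 0) y0)/=.
  exact: (ltW (d1P y (ltW y0) yb yd1)).
have := reparam_clock P0; rewrite clock0 => ->.
rewrite (reparam_clock Py); apply: d2P; first exact: ltW.
by rewrite subr0 gtr0_norm.
Qed.

Lemma reparam_length_le s t : 0 <= s -> s <= t ->
  mdist (U s) (U t) <= \int[mu]_(r in `[s, t]) (k r `^ (q' - 1)).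
Proof.
move=> s0 st.
have pos x : 0 < x -> x <= t ->
    mdist (U x) (U t) <= \int[mu]_(r in `[x, t]) (k r `^ (q' - 1)).
  move=> x0 xt; apply: slowing_length_le.
  - exact: xt.
  - apply: integrable_subitv (reparam_rate_integrable (lt_le_trans x0 xt)) => //.
    exact: ltW.
  - by move=> z; exact: powR_ge0.
  - move=> z y xz zy _; apply: ge0_ler_powR; rewrite ?nnegrE; first exact: ltW.
    + exact: slope_reparam_ge0.
    + exact: slope_reparam_ge0.
    + exact: (slope_reparam_ni (lt_le_trans x0 xz) zy).
  - by move=> z y xz zy _; apply: reparam_dist_le zy; exact: lt_le_trans xz.
move: s0; rewrite le_eqVlt => /predU1P[s0|s0]; last exact: pos.
rewrite -s0 {s0} in st *.
move: st; rewrite le_eqVlt => /predU1P[<-|t0].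
  by rewrite mdistxx; apply: Rintegral_ge0 => r _; exact: powR_ge0.
apply/ler_addgt0Pl => d d0.
have [x /andP[x0 xt] xd] := reparam_near0 t0 d0.
apply: le_trans (metric_triangle (U 0) (U x) (U t)) _.
apply: lerD; first exact: ltW.
apply: le_trans (pos _ x0 xt) _.
rewrite (Rintegral_chasles (ltW x0) xt (reparam_rate_integrable t0)) lerDr.
by apply: Rintegral_ge0 => r _; exact: powR_ge0.
Qed.

Lemma reparam_CMS : CMS f p' +oo%E u0 U.
Proof.
split.
- exists (fun r => k r `^ (q' - 1)); split.
    move=> K K0 cK.
    have [M [_ MK]] := compact_bounded cK.
    have M10 : 0 < `|M| + 1 by rewrite ltr_wpDl.
    have KM : K `<=` `[0, `|M| + 1].
      move=> x Kx; have [x0 _] := K0 _ Kx; rewrite /= in_itv/= x0/=.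
      rewrite -(ger0_norm x0); apply: (MK (`|M| + 1)) => //.
      by rewrite ltr_pwDr// ler_norm.
    apply: integrableS (reparam_rate_integrable M10); [|exact: compact_measurable|exact: KM].
    exact: measurable_itv.
  move=> s t [s0 _] [t0 _] st.
  have := reparam_length_le s0 st.
  rewrite -lee_fin /Rintegral fineK//; apply: integrable_fin_num => //.
  have t10 : 0 < t + 1 by rewrite ltr_wpDl.
  by apply: integrable_subitv (reparam_rate_integrable t10) => //; rewrite lerDl.
- exact: reparam0.
- by move=> s t [s0 _] _ st; exact: energy_reparam_ni.
- have nz : {ae mu, forall s : R, s != 0}.
    exists [set 0]; split => //; first exact: lebesgue_measure_set1.
    by move=> s /negP; rewrite negbK => /eqP.
  apply: ae_imply (ae_and nz reparam_regular_ae) => s [sn0 sreg] [s0 _].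
  have s0' : 0 < s by rewrite lt_neqAle eq_sym sn0.
  have [sfin dE dU] := sreg s0'.
  exact: max_slope_ineqI p'1 sfin dE dU.
Qed.

End reparametrized.

(** * The inverse time change *)

Section inverse.
Context {R : realType} {S : completeMetricType R}.
Notation mu := (@lebesgue_measure R).

Lemma constant_of_deriv0 (F : R -> R) (C a b : R) : a <= b ->
  (forall x y, a <= x -> x <= y -> y <= b -> `|F y - F x| <= C * (y - x)) ->
  {ae mu, forall x, a < x < b -> deriv_at F x 0} -> F b = F a.
Proof.
move=> ab FC dF.
have C0 : 0 <= `|C| by [].
have iC : mu.-integrable `[a, b] (EFin \o cst `|C|).
  by apply: (@integrable_bounded_itv _ _ _ _ `|C|) => //= x _; rewrite C0 lexx.
have FC' x y : a <= x -> x <= y -> y <= b ->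
    `|F y - F x| <= \int[mu]_(r in `[x, y]) (cst `|C| r).
  move=> ax xy yb; rewrite (Rintegral_itv_cst _ xy).
  apply: le_trans (FC x y ax xy yb) _; apply: ler_wpM2r; last exact: ler_norm.
  by rewrite subr_ge0.
have near_F x e : a < x < b -> deriv_at F x 0 -> 0 < e ->
    \forall y \near x^'+, `|F y - F x| <= e * (y - x).
  move=> axb dFx e0; near=> y.
  have xy : x < y by near: y; exact: nbhs_right_gt.
  have : `|F y - F x - 0 * (y - x)| <= e * `|y - x|.
    by near: y; apply: near_right_of_near; exact: dFx.
  by rewrite mul0r subr0 (gtr0_norm (_ : 0 < y - x)) ?subr_gt0.
apply/eqP; rewrite eq_le; apply/andP; split.
  apply: (nonincreasing_of_dini ab iC) => //.
    move=> x y ax xy yb; exact: le_trans (ler_norm _) (FC' x y ax xy yb).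
  apply: ae_imply dF => x dFx axb e e0; near=> y.
  by apply: (le_trans (ler_norm _)); near: y; exact: near_F (dFx axb) e0.
rewrite -lerN2.
apply: (@nonincreasing_of_dini _ (fun x => - F x) _ _ _ ab iC) => //.
  move=> x y ax xy yb; rewrite -opprD; apply: le_trans (ler_norm _) _.
  by rewrite normrN; exact: FC'.
apply: ae_imply dF => x dFx axb e e0; near=> y.
rewrite -opprD; apply: (le_trans (ler_norm _)); rewrite normrN.
by near: y; exact: near_F (dFx axb) e0.
Unshelve. all: end_near. Qed.

Lemma deriv_atB (F G : R -> R) x l : deriv_at F x l -> deriv_at G x l ->
  deriv_at (fun y => F y - G y) x 0.
Proof.
move=> dF dG e e0; have e20 : 0 < e / 2 by rewrite divr_gt0.
near=> y.
have H1 : `|F y - F x - l * (y - x)| <= e / 2 * `|y - x| by near: y; exact: dF.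
have H2 : `|G y - G x - l * (y - x)| <= e / 2 * `|y - x| by near: y; exact: dG.
have -> : F y - G y - (F x - G x) - 0 * (y - x) =
  (F y - F x - l * (y - x)) - (G y - G x - l * (y - x)) by ring.
apply: le_trans (ler_normB _ _) _.
have -> : e * `|y - x| = e / 2 * `|y - x| + e / 2 * `|y - x|.
  by rewrite -mulrDl -splitr.
exact: (lerD H1 H2).
Unshelve. all: end_near. Qed.

Variable f : S -> \bar R.
Hypothesis f_gtNy : forall v, (-oo < f v)%E.
Hypothesis f_lsc : lower_semicontinuous f.
Variable p0 : R.
Hypothesis f_convex : plambda_convex p0 0 f.
Variables (p p' : R) (u0 : S) (u : R -> S).
Hypotheses (p1 : 1 < p) (p'1 : 1 < p') (u0f : effective_domain f u0).
Hypothesis uC : CMS f p +oo%E u0 u.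

Local Notation q := (conj_exponent p).
Local Notation q' := (conj_exponent p').
Local Notation al := (conj_exponent p - conj_exponent p').
Local Notation al' := (conj_exponent p' - conj_exponent p).
Local Notation P := (active f u).
Local Notation h := (slope_along f u).
Local Notation sg := (clock h al).
Local Notation U := (reparam f p p' u).
Local Notation P' := (active f U).
Local Notation k := (slope_along f U).
Local Notation cl := (clock k al').

#[local] Opaque local_slope clock time_change reparam.

Let D := flow_clockable f_gtNy f_convex p1 p'1 u0f uC.
Let UC := reparam_CMS f_gtNy f_lsc f_convex p1 p'1 u0f uC.
Let D' := flow_clockable f_gtNy f_convex p'1 p1 u0f UC.

Lemma active_reparam t : P t -> P' (sg t).
Proof.
move=> Pt; split.
  by rewrite -(clock0 h al); exact: (clock_le D Pt (lexx 0) (period_ge0 D Pt)).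
rewrite (reparam_clock f_gtNy f_convex p1 p'1 u0f uC Pt).
by case: Pt.
Qed.

Lemma reparam_active s : P' s -> exists2 t, P t & sg t = s.
Proof.
move=> [s0 ks]; have [//|over] := clock_cases D s0.
move: ks; rewrite (reparam_over over).
by rewrite (endpoint_slope f_gtNy f_lsc f_convex p1 p'1 u0f uC over) ltxx.
Qed.

#[local] Opaque active slope_along.

Let T s := fine (time_change P h al s).

Let T_clock t : P t -> T (sg t) = t.
Proof. by move=> Pt; rewrite /T (time_change_clock D Pt). Qed.

Let T_deriv : {ae mu, forall s, P' s -> 0 < s -> deriv_at T s (k s `^ al')}.
Proof.
have N0 := clock_negligible D (clock_deriv D).
apply: negligibleS N0 => s /= /not_implyP[P's /not_implyP[s0 nd]].
have [t Pt ts] := reparam_active P's.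
have t0 : 0 < t.
  rewrite lt_neqAle (period_ge0 D Pt) andbT.
  by apply: contraTneq s0 => t0; rewrite -ts -t0 clock0 ltxx.
exists t => //; split; last by split.
move=> /(_ t0 Pt) dsg; apply: nd; rewrite -ts.
rewrite (slope_reparam_clock f_gtNy f_convex p1 p'1 u0f uC Pt).
apply: (deriv_at_clock D Pt t0 dsg (F := id)) => [|y Py]; last exact: T_clock.
have ht : 0 < h t := rate_gt0 D Pt t0.
have -> : h t `^ al' * h t `^ al = 1.
  rewrite -powRD; last by rewrite (gt_eqF ht) implybT.
  by rewrite (_ : al' + al = 0) ?powRr0//; ring.
move=> e e0; near=> y.
by rewrite mul1r subrr normr0 mulr_ge0// ltW.
Unshelve. all: end_near. Qed.

(** The inverse of the first clock and the second clock have the same derivative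
   almost everywhere: [h^(q'-q)] is the reciprocal of the rate [h^(q-q')].  Both
   are Lipschitz between positive times, so that they differ by a constant. *)
Lemma clock_inverse_diff a b : P b -> 0 < a -> a <= b ->
  b - cl (sg b) = a - cl (sg a).
Proof.
move=> Pb a0 ab.
have Pa := period_down D Pb (ltW a0) ab.
have sab := clock_le D Pb (ltW a0) ab.
have sa0 : 0 < sg a by rewrite -(clock0 h al); exact: (clock_lt D Pa (lexx 0) a0).
have [c [C [c0 C0 cC]]] := clock_rate D Pb a0 ab.
have [d [E [d0 E0 dE]]] := clock_rate D' (active_reparam Pb) sa0 sab.
have Tlip x y : sg a <= x -> x <= y -> y <= sg b -> `|T y - T x| <= c^-1 * (y - x).
  move=> ax xy yb.
  have y0 : 0 <= y by rewrite (le_trans (ltW sa0))// (le_trans ax).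
  have x0 : 0 <= x by rewrite (le_trans (ltW sa0)).
  have [y' Py' yE] := clock_ivt D Pb y0 yb.
  have [x' Px' xE] := clock_ivt D Pb x0 (le_trans xy yb).
  move: ax xy yb; rewrite -xE -yE (clock_le_mono D Pa Px') (clock_le_mono D Px' Py').
  rewrite (clock_le_mono D Py' Pb) (T_clock Px') (T_clock Py') => ax xy yb.
  rewrite ger0_norm ?subr_ge0// mulrC ler_pdivlMr// mulrC.
  by case/andP: (cC x' y' ax xy yb).
rewrite -{1}(T_clock Pb) -{1}(T_clock Pa).
apply: (@constant_of_deriv0 (fun s => T s - cl s) (c^-1 + E) _ _ sab).
  move=> x y ax xy yb.
  have -> : T y - cl y - (T x - cl x) = (T y - T x) - (cl y - cl x) by ring.
  apply: le_trans (ler_normB _ _) _; rewrite mulrDl; apply: lerD; first exact: Tlip.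
  have /andP[H1 H2] := dE x y ax xy yb.
  rewrite ger0_norm//; apply: le_trans H1.
  by rewrite mulr_ge0 ?subr_ge0// ltW.
apply: ae_imply (ae_and T_deriv (clock_deriv D')) => x [dT dc] /andP[ax xb].
have x0 : 0 < x := lt_trans sa0 ax.
have P'x : P' x := period_down D' (active_reparam Pb) (ltW x0) (ltW xb).
exact: deriv_atB (dT P'x x0) (dc x0 P'x).
Qed.

(** The constant is [0], since both clocks start from [0] continuously. *)
Lemma clock_inverse b : P b -> cl (sg b) = b.
Proof.
move=> Pb; have := period_ge0 D Pb; rewrite le_eqVlt => /predU1P[<-|b0].
  by rewrite !clock0.
apply/esym/eqP; rewrite -subr_eq0 -normr_eq0 eq_le normr_ge0 andbT.
apply/ler_addgt0Pl => e e0; rewrite addr0.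
have e20 : 0 < e / 2 by rewrite divr_gt0.
have [d1 d10 d1P] := clock_small D' (active_reparam Pb) e20.
have [d2 d20 d2P] := clock_small D Pb d10.
pose a := Num.min b (Num.min (d2 / 2) (e / 2)).
have a0 : 0 < a by rewrite !lt_min b0 !divr_gt0.
have ab : a <= b by rewrite ge_min lexx.
have ad2 : a < d2.
  apply: (@le_lt_trans _ _ (d2 / 2)); first by rewrite /a !ge_min lexx !orbT.
  by rewrite ltr_pdivrMr// ltr_pMr// ltr1n.
have ae2 : a <= e / 2 by rewrite /a !ge_min lexx !orbT.
have sa := d2P a (ltW a0) ab ad2.
have sa0 : 0 <= sg a.
  rewrite -(clock0 h al).
  exact: (clock_le D (period_down D Pb (ltW a0) ab) (lexx 0) (ltW a0)).
have ca := d1P (sg a) sa0 (clock_le D Pb (ltW a0) ab) sa.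
have ca0 : 0 <= cl (sg a).
  rewrite -(clock0 k al').
  apply: (clock_le D' _ (lexx 0) sa0).
  exact: (active_reparam (period_down D Pb (ltW a0) ab)).
rewrite (clock_inverse_diff Pb a0 ab).
apply: le_trans (ler_normB _ _) _.
rewrite (ger0_norm (ltW a0)) (ger0_norm ca0) [leRHS]splitr.
exact: lerD ae2 (ltW ca).
Qed.

(** Before the end of the active period this is [clock_inverse].  Afterwards [u] is
   at rest, and the second time change has reached the end of the new active
   period: the new curve either is at its endpoint already or, if the new period
   is infinite, converges to it. *)
Lemma reparam_inverse r : 0 <= r -> u r = reparam f p' p U r.
Proof.
move=> r0.
suff : curve_at U (time_change P' k al' r) = u r by [].
have [Pr|nPr] := pselect (P r).
  rewrite -[X in time_change _ _ _ X](clock_inverse Pr).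
  rewrite (time_change_clock D' (active_reparam Pr)).
  exact: (reparam_clock f_gtNy f_convex p1 p'1 u0f uC Pr).
have over s : P' s -> cl s <= r.
  move=> /reparam_active[t Pt <-]; rewrite (clock_inverse Pt) leNgt.
  by apply/negP => rt; apply: nPr; exact: (period_down D Pt r0 (ltW rt)).
rewrite (time_change_over over).
have [[_ Pall]|[T1 [T10 TE PT sT uT]]] := active_cases f_gtNy f_convex p1 p'1 u0f uC.
  by exfalso; apply: nPr; exact: Pall.
have -> : u r = u T1 by apply: uT; rewrite leNgt; apply/negP => /(PT _ r0).
have [[-> P'all]|[Sg [Sg0 -> P'Sg _ _]]] :=
    active_cases f_gtNy f_convex p'1 p1 u0f UC; last first.
  have nP'Sg : ~ P' Sg by move=> /(P'Sg _ Sg0); rewrite ltxx.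
  have [[t Pt tS]|overS] := clock_cases D Sg0.
    by exfalso; apply: nP'Sg; rewrite -tS; exact: active_reparam.
  rewrite /= (reparam_over overS) TE//.
apply/cvg_lim; first exact: metric_hausdorff.
apply/metricType_numDomainType.cvgrPdist_lt => e e0.
have [d d0 dP] := CMS_continuous uC T10 e0.
have T10' : 0 < T1.
  have [t Pt _] := reparam_active (P'all 0 (lexx 0)).
  by apply: (le_lt_trans (period_ge0 D Pt)); apply/(PT _ (period_ge0 D Pt)).
pose t1 := Num.max 0 (T1 - d / 2).
have t10 : 0 <= t1 by rewrite le_max lexx.
have t1T : t1 < T1 by rewrite gt_max T10'/= ltrBlDr ltrDl divr_gt0.
have Pt1 : P t1 by apply/(PT _ t10).
have sg10 : 0 <= sg t1.
  by rewrite -(clock0 h al); exact: (clock_le D Pt1 (lexx 0) t10).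
near=> s.
have s1 : sg t1 < s by near: s; apply: nbhs_pinfty_gt; exact: num_real.
have [t Pt ts] := reparam_active (P'all s (ltW (le_lt_trans sg10 s1))).
rewrite -ts (reparam_clock f_gtNy f_convex p1 p'1 u0f uC Pt).
have t0 := period_ge0 D Pt.
have tT : t < T1 by apply/(PT _ t0).
have t1t : t1 <= t by rewrite -(clock_le_mono D Pt1 Pt) ts ltW.
clear nPr over; apply: dP; first exact: t0.
rewrite ltr0_norm ?subr_lt0// opprB ltrBlDr -ltrBlDl.
apply: lt_le_trans t1t; rewrite lt_max; apply/orP; right.
by rewrite ltrD2l ltrN2 ltr_pdivrMr// ltr_pMr// ltr1n.
Unshelve. all: end_near. Qed.

End inverse.

Theorem theorem1p3 (R : realType) (S : completeMetricType R) (f : S -> \bar R)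
    (f_gtNy : forall v, (-oo < f v)%E)
    (f_proper : effective_domain f !=set0)
    (f_lsc : lower_semicontinuous f)
    (p0 : R) (p0_gt1 : 1 < p0)
    (f_convex : plambda_convex p0 0 f) :
  exists tmap : R -> R -> (R -> S) -> R -> \bar R,
  forall (p p' : R) (u0 : S) (u : R -> S),
    1 < p -> 1 < p' -> effective_domain f u0 -> CMS f p +oo%E u0 u ->
    let t := tmap p p' u in
    let u' := curve_at u \o t in
    let t' := tmap p' p u' in
    [/\ [/\ {in `[0, +oo[ &, {homo t : r s / r <= s >-> (r <= s)%E}},
            {within `[0, +oo[, continuous t} &
            forall s : R, 0 <= s -> (0 <= t s <= Tstar f +oo u)%E],
        ((exists2 s : R, 0 <= s & t s = +oo%E) -> cvg (u r @[r --> +oo%R])) /\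
        CMS f p' +oo%E u0 u',
        (forall v, CMS f p +oo%E u0 v -> {in `[0, +oo[, u =1 v} ->
          {in `[0, +oo[, t =1 tmap p p' v}) &
        ((exists2 s : R, 0 <= s & t' s = +oo%E) -> cvg (u' r @[r --> +oo%R])) /\
        {in `[0, +oo[, u =1 curve_at u' \o t'}].
Proof.
exists (fun p p' u => time_change (active f u) (slope_along f u)
                        (conj_exponent p - conj_exponent p')).
move=> p p' u0 u p1 p'1 u0f uC t u' t'.
have UC : CMS f p' +oo%E u0 u' :=
  reparam_CMS f_gtNy f_lsc f_convex p1 p'1 u0f uC.
have D := flow_clockable f_gtNy f_convex p1 p'1 u0f uC.
split.
- split; [|exact: (time_change_continuous D)|].
    by move=> r s _ _ rs; exact: time_change_mono.
  move=> s s0; apply/andP; split; first exact: time_change_ge0.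
  exact: le_trans (time_change_le_end _ _ _ _) (end_time_le_Tstar f u).
- split; last exact: UC.
  by move=> [s s0 ts]; exact: (time_change_attained f_gtNy f_convex p1 p'1 u0f uC s0 ts).
- move=> v _ uv s _.
  have uvt r : 0 <= r -> u r = v r by move=> r0; apply: uv; rewrite in_itv/= r0.
  apply: time_change_ext => [r r0|]; first by rewrite /slope_along uvt.
  by apply/seteqP; split => r [r0 hr]; (split; first exact: r0);
     [rewrite -(uvt r r0)|rewrite (uvt r r0)].
- split.
    by move=> [s s0 ts]; exact: (time_change_attained f_gtNy f_convex p'1 p1 u0f UC s0 ts).
  move=> r; rewrite in_itv/= andbT => r0.
  exact: (reparam_inverse f_gtNy f_lsc f_convex p1 p'1 u0f uC r0).
Qed.
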